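(* Let $m\ge 0$ and $p\ge 1$ be integers, and let $\zeta_N$ be any $N$th root of unity ($N\ge 1$). Then $$\mathbb{F}_{m,p}(\zeta_N)=\mathbb{U}_{m+1,p}(-1;\zeta_N^{-1}).$$
   Context: Notation: $(a)_n=(a;q)_n=\prod_{k=0}^{n-1}(1-aq^k)$, and for $0\le k\le n$, $\begin{bmatrix} n\\k\end{bmatrix}=\frac{(q)_n}{(q)_{n-k}(q)_k}$ (a polynomial in $q$), where $(q)_n=(q;q)_n$. Empty products equal $1$. For integers $m\ge 1$ and $p\ge 1$ define $$ \begin{aligned} \mathbb{F}_{m,p}(q)={}&q^p\sum_{n_{(2m+1)p}\ge\cdots\ge n_1\ge 0}(q)_{n_{(2m+1)p}}(-1)^{n_{(2m+1)p}}q^{-\binom{n_{(2m+1)p}+1}{2}}\prod_{\substack{1\le i<j\le(2m+1)p\\ (2m+1)\nmid i\\ j\not\equiv m+1\ (\mathrm{mod}\ 2m+1)}}q^{\Delta_{i,j,m}n_in_j}\\ &\times\prod_{\substack{1\le i\le(2m+1)p-1\\ i\equiv m+1\text{ or }2m+1\ (\mathrm{mod}\ 2m+1)}}(-1)^{n_i}q^{\binom{n_i+1}{2}}\ \prod_{i=1}^{(2m+1)p-1}q^{\beta_{i,m}n_i}\begin{bmatrix} n_{i+1}\\ n_i\end{bmatrix}, \end{aligned} $$ where, for $1\le i<j\le(2m+1)p$ with $(2m+1)\nmid i$ and $j\not\equiv m+1\pmod{2m+1}$, $\Delta_{i,j,m}=1$ if $j\equiv -i$ or $-i+1\pmod{2m+1}$,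 $\Delta_{i,j,m}=-1$ if $j\equiv i$ or $i+1\pmod{2m+1}$, and $\Delta_{i,j,m}=0$ otherwise; and, for $1\le i\le(2m+1)p-1$, $\beta_{i,m}=1$ if $i\equiv 1,\dots,m\pmod{2m+1}$, $\beta_{i,m}=-1$ if $i\equiv m+1,\dots,2m\pmod{2m+1}$, and $\beta_{i,m}=0$ if $i\equiv 0\pmod{2m+1}$. For $m=0$ and $p\ge 1$ define $$\mathbb{F}_{0,p}(q)=q^p\sum_{n_p\ge\cdots\ge n_1\ge 0}(q)_{n_p}\prod_{i=1}^{p-1}q^{n_i^2+n_i}\begin{bmatrix} n_{i+1}\\ n_i\end{bmatrix};$$ in particular $\mathbb{F}_{0,1}(q)=q\sum_{n\ge0}(q)_n$. For integers $m,p\ge 1$ define $$ \mathbb{U}_{m,p}(x;q)=q^{-p}\sum_{\substack{n\ge 0\\ n=n_m\ge n_{m-1}\ge\cdots\ge n_1\ge 0\\ n=s_p\ge s_{p-1}\ge\cdots\ge s_1\ge 0}}\frac{(-xq)_n(-x^{-1}q)_n}{(q)_{n_1}}(-1)^nq^{-\binom{n+1}{2}}\prod_{i=1}^{m-1}q^{n_i^2+n_i}\begin{bmatrix} n_{i+1}\\ n_i\end{bmatrix}\prod_{j=1}^{p-1}q^{-s_j-s_{j+1}s_j}\begin{bmatrix} s_{j+1}\\ s_j\end{bmatrix}. $$ These series are evaluated only at $q$ a root of unity (and $x=-1$ for $\mathbb{U}_{m,p}$), where they are finite sums: if $q$ has order $d$, then $(q)_n=0$ for $n\ge d$, and in $\mathbb{U}_{m,p}(-1;q)$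 the quotient $(q)_n(q)_n/(q)_{n_1}$ with $n_1\le n$ is read as the polynomial $(q)_n\cdot\frac{(q)_n}{(q)_{n_1}}$, which also vanishes for $n\ge d$. *)

(* Defs.v *)
From HB Require Import structures.
From mathcomp Require Import all_boot all_order all_algebra.
From mathcomp Require Import boolp classical_sets functions cardinality fsbigop.

Set Implicit Arguments.
Unset Strict Implicit.
Unset Printing Implicit Defensive.
Import Order.TTheory GRing.Theory Num.Theory.

Local Open Scope classical_set_scope.
Local Open Scope ring_scope.

Definition qpoch (R : nzRingType) (a q : R) (n : nat) : R :=
  \prod_(0 <= k < n) (1 - a * q ^+ k).

(* The Gaussian binomial as a polynomial in q = 'X: the Euclidean quotient is
   exact for k <= n (lemma qbinE); k > n never occurs below.  As a polynomial
   it can be evaluated at roots of unity. *)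
Definition qbin (K : fieldType) (n k : nat) : {poly K} :=
  qpoch 'X 'X n %/ (qpoch 'X 'X (n - k) * qpoch 'X 'X k).

(* A finite sequence n_1, ..., n_r is an r-tuple t, and t`[i] is n_i for
   1 <= i <= r: the indices start at 1. *)
Definition part (t : seq nat) (i : nat) : nat := nth 0%N t i.-1.
Local Notation "t `[ i ]" := (part t i)
  (at level 2, left associativity, format "t `[ i ]").

(* The set of r-tuples with n_r >= ... >= n_1 >= 0. *)
Definition chain (r : nat) : set (r.-tuple nat) :=
  [set t : r.-tuple nat | sorted leq t].
Arguments chain r : clear implicits.

Definition Delta (m i j : nat) : int :=
  let M := (2 * m + 1)%N in
  if (i + j == 0 %[mod M])%N || (i + j == 1 %[mod M])%N then 1
  else if (j == i %[mod M])%N || (j == i.+1 %[mod M])%N then -1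
  else 0.

Definition beta (m i : nat) : int :=
  let r := (i %% (2 * m + 1))%N in
  if (1 <= r <= m)%N then 1
  else if (m.+1 <= r <= 2 * m)%N then -1
  else 0.

Definition F_pos_summand (K : fieldType) (m p : nat) (q : K) (n : seq nat) : K :=
  let M := (2 * m + 1)%N in
  let r := (M * p)%N in
  qpoch q q n`[r] * (-1) ^+ n`[r] * q ^ (- ('C(n`[r].+1, 2))%:Z)
  * (\prod_(1 <= j < r.+1)
       \prod_(1 <= i < j | ~~ (M %| i)%N && (j != m.+1 %[mod M])%N)
          q ^ (Delta m i j * (n`[i] * n`[j])%N%:Z))
  * (\prod_(1 <= i < r | (i == m.+1 %[mod M])%N || (i == M %[mod M])%N)
       ((-1) ^+ n`[i] * q ^ ('C(n`[i].+1, 2))%:Z))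
  * \prod_(1 <= i < r)
       (q ^ (beta m i * n`[i]%:Z) * (qbin K n`[i.+1] n`[i]).[q]).

Definition F_zero_summand (K : fieldType) (p : nat) (q : K) (n : seq nat) : K :=
  qpoch q q n`[p]
  * \prod_(1 <= i < p)
      (q ^+ (n`[i] ^ 2 + n`[i])%N * (qbin K n`[i.+1] n`[i]).[q]).

(* [\sum_(t \in A) f t] is the sum of the nonzero values of f on the infinite
   set A, provided there are finitely many of them (otherwise it is 0); see the
   lemmas *_finite_support for roots of unity. *)
Definition F_pos (K : fieldType) (m p : nat) (q : K) : K :=
  q ^+ p * \sum_(n \in chain ((2 * m + 1) * p)%N) F_pos_summand m p q n.

Definition F_zero (K : fieldType) (p : nat) (q : K) : K :=
  q ^+ p * \sum_(n \in chain p) F_zero_summand p q n.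

Definition F (K : fieldType) (m p : nat) (q : K) : K :=
  if m == 0%N then F_zero p q else F_pos m p q.

(* The quotient by (q)_{n_1} is taken in K.  For x = -1 and q of order d, the
   numerator vanishes when n >= d, so that the quotient is 0 (also when the
   denominator is 0), and (q)_{n_1} <> 0 when n_1 <= n < d: this is the value
   of the polynomial (q)_n * ((q)_n / (q)_{n_1}). *)
Definition U_summand (K : fieldType) (m p : nat) (x q : K) (n s : seq nat) : K :=
  qpoch (- x * q) q n`[m] * qpoch (- x^-1 * q) q n`[m] / qpoch q q n`[1]
  * (-1) ^+ n`[m] * q ^ (- ('C(n`[m].+1, 2))%:Z)
  * (\prod_(1 <= i < m)
       (q ^+ (n`[i] ^ 2 + n`[i])%N * (qbin K n`[i.+1] n`[i]).[q]))
  * \prod_(1 <= j < p)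
       (q ^ (- s`[j]%:Z - (s`[j.+1] * s`[j])%N%:Z) * (qbin K s`[j.+1] s`[j]).[q]).

Definition U_index (m p : nat) : set (m.-tuple nat * p.-tuple nat) :=
  [set ns | [/\ chain m ns.1, chain p ns.2 & ns.1`[m] = ns.2`[p]]].
Arguments U_index m p : clear implicits.

Definition U (K : fieldType) (m p : nat) (x q : K) : K :=
  q ^- p * \sum_(ns \in U_index m p) U_summand m p x q ns.1 ns.2.

Section Facts.
Variable K : fieldType.

Lemma qpochS (R : nzRingType) (a q : R) n :
  qpoch a q n.+1 = qpoch a q n * (1 - a * q ^+ n).
Proof. by rewrite /qpoch big_nat_recr. Qed.

Lemma qpoch_dvd n k : (k <= n)%N ->
  (qpoch 'X 'X (n - k) * qpoch 'X 'X k : {poly K}) %| qpoch 'X 'X n.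
Proof.
elim: n k => [|n IHn] [|k] // le_kn.
- by rewrite /qpoch big_geq // mulr1 dvd1p.
- by rewrite subn0 /qpoch [X in _ * X]big_geq // mulr1 dvdpp.
rewrite subSS qpochS [X in _ %| X]qpochS.
have -> : 1 - 'X * 'X ^+ n =
    (1 - 'X * 'X ^+ k) + 'X ^+ k.+1 * (1 - 'X ^+ (n - k)) :> {poly K}.
  rewrite mulrBr mulr1 -exprD -!exprS addSn subnKC //.
  by rewrite addrA subrK.
rewrite [X in _ %| X]mulrDr; apply: dvdp_add.
  by rewrite mulrA dvdp_mul // IHn.
rewrite -qpochS; move: le_kn; rewrite ltnS leq_eqVlt => /predU1P[->|lt_kn].
  by rewrite subnn expr0 subrr !mulr0 dvdp0.
have -> : (n - k = (n - k.+1).+1)%N by rewrite subnSK.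
rewrite [qpoch _ _ (_ - _).+1]qpochS (exprS _ (n - k.+1)) mulrAC mulrA dvdp_mul //.
by rewrite dvdp_mulr // IHn.
Qed.

Lemma qbinE n k : (k <= n)%N ->
  qbin K n k * (qpoch 'X 'X (n - k) * qpoch 'X 'X k) = qpoch 'X 'X n.
Proof. by move=> /qpoch_dvd; apply: divpK. Qed.

Lemma qpoch_eq0 (q : K) N n : (0 < N <= n)%N -> q ^+ N = 1 -> qpoch q q n = 0.
Proof.
case: N => // N /= lt_Nn qN; rewrite /qpoch big_mkord.
by rewrite (bigD1 (Ordinal lt_Nn)) //= -exprS qN subrr mul0r.
Qed.


Lemma chain_bounded_finite r N :
  finite_set [set t : r.-tuple nat | chain r t /\ (t`[r] < N)%N].
Proof.
apply: (@sub_finite_set _ _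
  [set` [seq map_tuple (@nat_of_ord N) u | u : r.-tuple 'I_N]]); last first.
  exact: finite_seq.
move=> t [/= st lt_tN].
have tN (i : 'I_r) : (tnth t i < N)%N.
  apply: leq_ltn_trans lt_tN; rewrite (tnth_nth 0%N) /part.
  have i_lt := ltn_ord i.
  apply: (sorted_leq_nth leq_trans leqnn 0%N st); rewrite ?inE ?size_tuple //.
    by rewrite ltn_predL (leq_ltn_trans _ i_lt).
  by rewrite -ltnS prednK // (leq_ltn_trans _ i_lt).
apply/mapP; exists [tuple Ordinal (tN i) | i < r].
  by rewrite mem_enum.
by apply: eq_from_tnth => i; rewrite tnth_map tnth_mktuple.
Qed.

Lemma F_pos_finite_support m p (q : K) N : (0 < N)%N -> q ^+ N = 1 ->
  finite_set (chain ((2 * m + 1) * p)%N `&`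
              F_pos_summand m p q @^-1` [set~ 0]).
Proof.
move=> N0 qN; apply: sub_finite_set (chain_bounded_finite _ N).
move=> t [/= st nz]; split=> //; rewrite ltnNge; apply/negP => le_Nt.
apply: nz; rewrite /F_pos_summand (@qpoch_eq0 _ N) ?N0 //.
by rewrite !mul0r.
Qed.

Lemma F_zero_finite_support p (q : K) N : (0 < N)%N -> q ^+ N = 1 ->
  finite_set (chain p `&` F_zero_summand p q @^-1` [set~ 0]).
Proof.
move=> N0 qN; apply: sub_finite_set (chain_bounded_finite _ N).
move=> t [/= st nz]; split=> //; rewrite ltnNge; apply/negP => le_Nt.
by apply: nz; rewrite /F_zero_summand (@qpoch_eq0 _ N) ?N0 // !mul0r.
Qed.

Lemma U_finite_support m p (q : K) N : (0 < N)%N -> q ^+ N = 1 ->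
  finite_set (U_index m p `&`
              (fun ns : m.-tuple nat * p.-tuple nat =>
                 U_summand m p (-1) q ns.1 ns.2) @^-1` [set~ 0]).
Proof.
move=> N0 qN.
apply: sub_finite_set (finite_setX (chain_bounded_finite m N)
                                   (chain_bounded_finite p N)).
move=> [n s] [/= [/= cn cs ens] nz].
have lt_nN : (n`[m] < N)%N.
  rewrite ltnNge; apply/negP => le_Nn; apply: nz.
  by rewrite /U_summand opprK mul1r (@qpoch_eq0 q N) ?N0 // !mul0r.
by do 2!split=> //=; rewrite -ens.
Qed.

End Facts.

(* Main.v *)
(* The identity holds before summation over the largest index n: with
   Q = q^-1, both sides equal q^p times the sum over n of (Q)_n G_m(n) B_p(n),
   for any nonzero q; roots of unity only make the sum over n finite.
   Here eps(n) = (-1)^n q^binomial(n+1, 2), B_0(n) = [n = 0],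
   B_(p+1)(n) = sum_s q^(s^2+s) [n, s] B_p(s), G_0 = eps and
     G_(m+1)(n) = sum_t q^(-t-tn) [n, t] (q)_n / (q)_t G_m(t).
   On the U side this is just the inversion of the base in the definition.

   On the F side, cut the indices into p blocks
     x_1 <= ... <= x_m <= y_m <= ... <= y_1 <= y_0
   of length 2m+1, and let w_r = y_(r-1) - x_r.  Through the exponents Delta, a
   block interacts with the blocks above it only via the sums e_r over those
   blocks of the widths w_r.  Given x_1 and y_0, the weight of a block factors
   into eps(x_1) [y_0, x_1] and one factor for each layer r, which depends on
   w_r, w_(r+1), y_r - x_r and e_r + e_(r+1).  Summing over y_r - x_r, the
   transition from w_r to w_(r+1) is a kernel k_w(S; w') that satisfies the
   composition law
     sum_(w+u=W) k_a(S; w) k_b(S+a+w; u) = k_(a+b)(S; W).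
   Hence all the inner indices of all the blocks can be summed out, leaving a
   function of the total width of the blocks.  The remaining alternating sum
   over the x_1's and y_0's collapses to B_p. *)

Require Import Defs.
From mathcomp Require Import all_boot all_order all_algebra.
From mathcomp Require Import boolp classical_sets functions fsbigop.
From mathcomp Require Import ring zify.
Import GRing.Theory Num.Theory.
Local Open Scope ring_scope.

Set Implicit Arguments.
Unset Strict Implicit.
Unset Printing Implicit Defensive.

(** * Gaussian binomials *)

(** The q-Pascal rule makes sense for every q, including roots of unity, where the quotient of
    q-factorials can become 0/0. It gives 0 for k > n. *)
Fixpoint gbin (R : nzRingType) (q : R) (n k : nat) : R :=
  match n, k with
  | _, 0 => 1
  | 0, _.+1 => 0
  | n'.+1, k'.+1 => gbin q n' k' + q ^+ k'.+1 * gbin q n' k'.+1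
  end.

Section Gbin.
Variables (R : comNzRingType) (q : R).

Lemma gbin0 n : gbin q n 0 = 1. Proof. by case: n. Qed.

Lemma gbinS n k :
  gbin q n.+1 k.+1 = gbin q n k + q ^+ k.+1 * gbin q n k.+1.
Proof. by []. Qed.

Lemma gbin_small n k : (n < k)%N -> gbin q n k = 0.
Proof.
elim: n k => [|n IHn] [|k] //= lt_nk.
by rewrite !IHn ?mulr0 ?addr0 //; lia.
Qed.

Lemma gbinn n : gbin q n n = 1.
Proof. by elim: n => //= n ->; rewrite gbin_small // mulr0 addr0. Qed.

(** This is the difference of the two q-Pascal rules [gbinS] and [gbinS']. Both sides vanish for n
    <= k. *)
Lemma gbin_absorb n k :
  (1 - q ^+ (n - k)) * gbin q n k = (1 - q ^+ k.+1) * gbin q n k.+1.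
Proof.
elim: n k => [|n IHn] [|k].
- by rewrite subrr mul0r mulr0.
- by rewrite subrr mul0r mulr0.
- have eqA := IHn 0%N; rewrite gbinS !gbin0 in eqA *; rewrite !subn0 in eqA *.
  rewrite mulrDr [_ * (q ^+ 1 * _)]mulrCA -eqA exprS; ring.
have [lt_nk|le_kn] := ltnP n k.+1.
  rewrite [gbin q n.+1 k.+2]gbin_small ?mulr0; last by lia.
  have -> : (n.+1 - k.+1 = 0)%N by lia.
  by rewrite subrr mul0r.
rewrite [gbin q n.+1 k.+1]gbinS [gbin q n.+1 k.+2]gbinS subSS.
rewrite mulrDr IHn [in RHS]mulrDr [_ * (q ^+ k.+2 * _)]mulrCA -(IHn k.+1).
have -> : (n - k = (n - k.+1).+1)%N by lia.
by rewrite !exprS; ring.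
Qed.

Lemma gbinS' n k :
  gbin q n.+1 k.+1 = q ^+ (n - k) * gbin q n k + gbin q n k.+1.
Proof.
rewrite gbinS; apply/eqP;
  rewrite -subr_eq0 -(subrr ((1 - q ^+ k.+1) * gbin q n k.+1)).
by rewrite -{1}gbin_absorb; apply/eqP; ring.
Qed.

Lemma gbin_qpoch n k : (k <= n)%N ->
  gbin q n k * (qpoch q q (n - k) * qpoch q q k) = qpoch q q n.
Proof.
elim: k => [_|k IHk lt_kn].
  by rewrite subn0 gbin0 mul1r [X in _ * X]/qpoch big_geq ?mulr1.
rewrite -IHk; last by lia.
have -> : (n - k = (n - k.+1).+1)%N by lia.
rewrite !qpochS -!exprS.
have := gbin_absorb n k; have -> : (n - k = (n - k.+1).+1)%N by lia.
set g' := gbin q n k.+1; set g := gbin q n k => eqA.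
rewrite (_ : g' * _ =
  (1 - q ^+ k.+1) * g' * (qpoch q q (n - k.+1) * qpoch q q k)).
  by rewrite -eqA; ring.
by ring.
Qed.

End Gbin.

Arguments gbin : simpl never.

(** * Identities proved for polynomials and evaluated at q *)

Section GbinField.
Variable K : fieldType.

Lemma gbin_horner (q : K) n k : (gbin 'X n k).[q] = gbin q n k.
Proof.
elim: n k => [|n IHn] [|k]; rewrite ?gbin0 ?hornerC // ?horner0 //.
by rewrite !gbinS hornerD hornerM hornerXn !IHn.
Qed.

Lemma qpochX_neq0 n : qpoch 'X 'X n != 0 :> {poly K}.
Proof.
apply: contraTneq (oner_neq0 K) => /(congr1 (horner^~ 0)).
rewrite horner0 /qpoch horner_prod big1 => [->|i _]; first by rewrite eqxx.
by rewrite !hornerE ?mul0r ?oppr0 ?addr0.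
Qed.

(** For polynomials the q-factorials are nonzero and can be cancelled. Evaluation then gives the
    identities at every q, even where the q-factorials vanish. *)
Lemma gbinX_unique n k (P : {poly K}) : (k <= n)%N ->
  P * (qpoch 'X 'X (n - k) * qpoch 'X 'X k) = qpoch 'X 'X n ->
  P = gbin 'X n k.
Proof.
move=> le_kn eqP; have nz : qpoch 'X 'X (n - k) *
  qpoch 'X 'X k != 0 :> {poly K}.
  by rewrite mulf_neq0 ?qpochX_neq0.
by apply: (mulIf nz); rewrite eqP gbin_qpoch.
Qed.

Lemma qbin_gbin (q : K) n k : (k <= n)%N -> (qbin K n k).[q] = gbin q n k.
Proof.
by move=> le_kn; rewrite (gbinX_unique le_kn (qbinE K le_kn)) gbin_horner.
Qed.

Variable q : K.
Local Notation "[ n , k ]" := (gbin q n k) (at level 0, format "[ n ,  k ]").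

Lemma gbin_sub n k : (k <= n)%N -> [n, n - k] = [n, k].
Proof.
move=> le_kn; rewrite -!gbin_horner; congr (_.[q]); apply: gbinX_unique => //.
by rewrite -[RHS](gbin_qpoch 'X (leq_subr k n)) subKn // [X in _ = _ * X]mulrC.
Qed.

Lemma gbin_trinomial n m k : (k <= m <= n)%N ->
  [n, m] * [m, k] = [n, k] * [n - k, m - k].
Proof.
case/andP=> le_km le_mn; rewrite -!gbin_horner -!hornerM; congr (_.[q]).
have nz : qpoch 'X 'X (n - m) * qpoch 'X 'X k *
  qpoch 'X 'X (m - k) != 0 :> {poly K}.
  by rewrite !mulf_neq0 ?qpochX_neq0.
apply: (mulIf nz); transitivity (qpoch 'X 'X n : {poly K}).
  by rewrite -(gbin_qpoch 'X le_mn) -(gbin_qpoch 'X le_km); ring.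
have le_kn := leq_trans le_km le_mn.
have le_mk : (m - k <= n - k)%N by lia.
rewrite -(gbin_qpoch 'X le_kn) -(gbin_qpoch 'X le_mk).
have -> : (n - k - (m - k) = n - m)%N by lia.
by ring.
Qed.

(** The rule [gbinS] in base q^-1 corresponds term by term to [gbinS'] in base q. *)
Lemma gbin_inv n k : q != 0 -> (k <= n)%N ->
  gbin q^-1 n k = q ^- (k * (n - k)) * [n, k].
Proof.
move=> nzq; elim: n k => [|n IHn] [|k] // le_kn.
- by rewrite !gbin0 mul0n invr1 mulr1.
- by rewrite !gbin0 mul0n invr1 mulr1.
have [eq_kn|lt_kn] := eqVneq k n.
  by rewrite eq_kn !gbinn subnn muln0 invr1 mulr1.
rewrite gbinS gbinS' !IHn; try by lia.
have [t def_n] : exists t, n = (k + t).+1 by exists (n - k.+1)%N; lia.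
rewrite def_n subSS !subSS (_ : (k + t).+1 - k = t.+1)%N; last by lia.
rewrite (_ : k + t - k = t)%N; last by lia.
set A := gbin _ _ _; set B := gbin _ _ _.
have e1 : q ^+ (k.+1 * t.+1) = q ^+ (k * t.+1) * q ^+ t.+1 by rewrite -exprD;
  congr (_ ^+ _); lia.
have e2 : q ^+ (k.+1 * t.+1) = q ^+ (k.+1 * t) * q ^+ k.+1 by rewrite -exprD;
  congr (_ ^+ _); lia.
rewrite [in RHS]mulrDr; congr (_ + _).
  by rewrite e1 invfM [RHS]mulrA -[X in _ =
    X * _]mulrA mulVf ?expf_neq0 // mulr1.
by rewrite e2 invfM mulrA exprVn [_^-1 / _]mulrC.
Qed.

End GbinField.

Lemma sum_nat_widen (R : nmodType) n N (f : nat -> R) : (n < N)%N ->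
  (forall t, (n < t)%N -> f t = 0) ->
  \sum_(0 <= t < N) f t = \sum_(0 <= t < n.+1) f t.
Proof.
move=> lt_nN f0; rewrite (@big_cat_nat _ _ _ n.+1) //= [X in _ +
  X]big_nat_cond [X in _ + X]big1 ?addr0 //.
by move=> t; rewrite andbT => /andP[? _]; apply: f0.
Qed.

Lemma sum_nat_rev (R : nmodType) n (f : nat -> R) :
  \sum_(0 <= t < n.+1) f t = \sum_(0 <= t < n.+1) f (n - t)%N.
Proof. by rewrite big_nat_rev /= !add0n; apply: eq_bigr => t _; rewrite subSS.
  Qed.

(** * Summation operators *)

Section Operators.
Variables (K : fieldType) (q : K).
Local Notation "[ n , k ]" := (gbin q n k) (at level 0, format "[ n ,  k ]").

Definition eps (n : nat) : K := (-1) ^+ n * q ^+ 'C(n.+1, 2).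

Lemma eps0 : eps 0 = 1. Proof. by rewrite /eps mulr1. Qed.

Lemma epsD a b : eps (a + b) = eps a * eps b * q ^+ (a * b).
Proof.
have -> : eps (a + b) = (-1) ^+ a * (-1) ^+ b * (q ^+ 'C(a.+1,
  2) * q ^+ 'C(b.+1, 2) * q ^+ (a * b)).
  rewrite /eps -!exprD. congr (_ * _); congr (_ ^+ _).
  elim: b => [|b IHb]; first by rewrite muln0 !addn0.
  by rewrite addnS binS bin1 IHb (binS b.+1) bin1; lia.
by rewrite /eps; ring.
Qed.

Lemma epsS a : eps a.+1 = - (q ^+ a.+1 * eps a).
Proof. by rewrite -addn1 epsD muln1 exprD /eps /=; ring. Qed.

Lemma eps_sqr a : eps a * eps a = q ^+ (a ^ 2 + a).
Proof.
elim: a => [|a IHa]; first by rewrite eps0 mulr1.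
rewrite epsS; transitivity (q ^+ a.+1 * q ^+ a.+1 * (eps a * eps a));
  first by ring.
by rewrite IHa -!exprD; congr (_ ^+ _); nia.
Qed.

(** The finite q-binomial theorem: [gbinS'] splits the sum into the two terms of the new factor 1 -
    a q^(n+1). *)
Lemma qbinomial n a :
  \sum_(0 <= t < n.+1) eps t * a ^+ t * [n, t] =
  \prod_(0 <= i < n) (1 - a * q ^+ i.+1).
Proof.
elim: n => [|n IHn].
  by rewrite big_nat1 big_geq // eps0 !mul1r.
rewrite [in RHS]big_nat_recr //= -IHn mulrBr mulr1 [LHS]big_nat_recl //.
under eq_bigr do rewrite gbinS' mulrDr.
rewrite big_split /= addrCA addrC; congr (_ + _).
  rewrite big_nat_recr //= [gbin q n n.+1]gbin_small // mulr0 addr0.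
  by rewrite [in RHS]big_nat_recl // !gbin0.
rewrite big_distrl -sumrN /=; apply: eq_big_nat => t /andP[_ le_tn].
have -> : q ^+ n.+1 = q ^+ t.+1 * q ^+ (n - t) by rewrite -exprD;
  congr (_ ^+ _); lia.
by rewrite epsS [a ^+ t.+1]exprS; ring.
Qed.

(** Trinomial revision with c = x + t; outside x <= c <= z one of the binomials vanishes. *)
Lemma sum_gbin_trinomial N z x (g : nat -> K) : (z < N)%N ->
  \sum_(0 <= c < N) [z, c] * [c, x] * g c =
  [z, x] * \sum_(0 <= t < (z - x).+1) [z - x, t] * g (x + t)%N.
Proof.
move=> lt_zN; have [lt_zx|le_xz] := ltnP z x.
  rewrite [ [z, x] ]gbin_small // mul0r big1_seq // => c _.
  have [lt_zc|le_cz] := ltnP z c;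
    first by rewrite [ [z, c] ]gbin_small // !mul0r.
  by rewrite [ [c, x] ]gbin_small ?mulr0 ?mul0r //; lia.
rewrite (@sum_nat_widen _ z) => [|//|c lt_zc];
  last by rewrite gbin_small ?mul0r.
rewrite (@big_cat_nat _ _ _ x) //=; last by lia.
rewrite big_nat_cond big1 ?add0r => [|c]; last first.
  by rewrite andbT => /andP[_ lt_cx];
    rewrite [ [c, x] ]gbin_small // mulr0 mul0r.
rewrite -{1}[x]add0n big_addn subSn // big_distrr;
  apply: eq_big_nat => t /andP[_ lt_t].
rewrite /= addnC gbin_trinomial; last by lia.
by rewrite mulrA addKn.
Qed.

Lemma sum_gbin_trinomial_rev N c x (g : nat -> K) : (c < N)%N ->
  \sum_(0 <= b < N) [c, b] * [b, x] * g b =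
  [c, x] * \sum_(0 <= t < (c - x).+1) [c - x, t] * g (c - t)%N.
Proof.
move=> lt_cN; rewrite sum_gbin_trinomial //; have [lt_cx|le_xc] := ltnP c x.
  by rewrite gbin_small // !mul0r.
congr (_ * _); rewrite sum_nat_rev; apply: eq_big_nat => t /andP[_ lt_t].
by rewrite gbin_sub //; congr (_ * g _); lia.
Qed.

(* [widthop v S h] is the sum over w of k_v(S; w) h w.  Growing v by one either
   keeps w or increments it, so that the composition law is an induction on b.
     *)
Fixpoint widthop (v : nat) (S : int) (h : nat -> K) : K :=
  if v is v'.+1 then
    widthop v' S (fun w => (1 - q ^ (- (S + v'%:Z + w%:Z + 1))) * h w
                       + q ^ (- (S + v'%:Z + w%:Z + 2)) * h w.+1)
  else h 0%N.

Lemma eq_widthop v S S' h h' : S = S' -> h =1 h' -> widthop v S h =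
  widthop v S' h'.
Proof.
move=> <-; elim: v h h' => [|v IHv] h h' eqh /=; first exact: eqh.
by apply: IHv => w; rewrite !eqh.
Qed.

Lemma widthop_comp a b (S : int) h :
  widthop a S (fun w => widthop b (S + a%:Z + w%:Z) (fun u => h (w + u)%N)) =
  widthop (a + b) S h.
Proof.
elim: b h => [|b IHb] h.
  by rewrite addn0; apply: eq_widthop => // w; rewrite /= addn0.
rewrite addnS /= -IHb; apply: eq_widthop => // w; apply: eq_widthop => // u.
by rewrite addnS; congr ((1 - q ^ (- _)) * _ + q ^ (- _) * _); lia.
Qed.

(** With E the shift of H by 1, this is the product of the operators E - q^(i+b), 1 <= i <= n,
    applied to H and evaluated at 0. [altsumS] takes out the last factor, and [altsum_comp] splits
    the product in two. *)
Definition altsum (b n : nat) (H : nat -> K) : K :=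
  \sum_(0 <= s < n.+1) eps s * q ^+ (b * s) * [n, s] * H (n - s)%N.

Lemma altsumE b n H :
  altsum b n H = \sum_(0 <= s < n.+1) eps s * q ^+ (b * s) * [n,
    s] * H (n - s)%N.
Proof. by []. Qed.

Lemma altsumS b n H :
  altsum b n.+1 H = altsum b n (fun t =>
    H t.+1) - q ^+ (n.+1 + b) * altsum b n H.
Proof.
rewrite /altsum [LHS]big_nat_recl //.
under eq_bigr do rewrite gbinS' mulrDr mulrDl.
rewrite big_split /= addrCA addrC; congr (_ + _).
  rewrite big_nat_recr //= [gbin q n n.+1]gbin_small // mulr0 mul0r addr0.
  rewrite [in RHS]big_nat_recl // !gbin0; congr (_ + _);
    first by rewrite !subn0.
  by apply: eq_big_nat => t /andP[_ lt_tn]; rewrite subSS; congr (_ * H _); lia.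
rewrite big_distrr -sumrN; apply: eq_big_nat => t /andP[_ lt_tn] /=.
have -> : q ^+ (n.+1 + b) = q ^+ t.+1 * q ^+ (n - t) * q ^+ b.
  by rewrite -!exprD; congr (_ ^+ _); lia.
by rewrite epsS mulnS exprD subSS; ring.
Qed.

Lemma altsum_comp a b H :
  altsum b a (fun u => altsum 0 b (fun t => H (u + t)%N)) = altsum 0 (a + b) H.
Proof.
elim: a H => [|a IHa] H.
  by rewrite /altsum big_nat1 eps0 muln0 gbin0 !mul1r; apply: eq_bigr.
by rewrite addSn !altsumS -!IHa addn0 -addSn.
Qed.

Lemma eq_altsum b n H H' : (forall t, (t <= n)%N -> H t =
  H' t) -> altsum b n H = altsum b n H'.
Proof. by move=> eqH; apply: eq_bigr => t _; rewrite eqH ?leq_subr. Qed.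

(** For x = y + s, eps(x) eps(y) = q^(y^2+y) eps(s) q^(ys), so the sum over s is [altsum y (z - y)],
    and [altsum_comp] applies. Here the signs of x_1 and y_0 turn into the Gaussian weight of
    B_p. *)
Lemma altsum_twist N z y H : (z < N)%N ->
  \sum_(0 <= x < N) [z, x] * [x, y] *
     (eps x * eps y * altsum 0 y (fun t => H (z - x + t)%N)) =
  q ^+ (y ^ 2 + y) * [z, y] * altsum 0 z H.
Proof.
move=> lt_zN; rewrite sum_gbin_trinomial //; have [lt_zy|le_yz] := ltnP z y.
  by rewrite gbin_small // !(mul0r, mulr0).
rewrite [_ * [z, y] ]mulrC -mulrA; congr (_ * _).
have -> : altsum 0 z H = altsum 0 (z - y + y) H by rewrite subnK.
rewrite -altsum_comp [X in _ = _ * X]altsumE big_distrr;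
  apply: eq_big_nat => s /andP[_ lt_s].
rewrite epsD -eps_sqr.
have -> : altsum 0 y (fun t => H (z - (y + s) + t)%N) = altsum 0 y (fun t =>
  H (z - y - s + t)%N).
  by apply: eq_altsum => t _; congr (H _); lia.
by rewrite /=; ring.
Qed.

(* The contribution of blocks of total width V, summed over the widths of the
   inner layers, below blocks of which the widths of layer r+1 sum up to e r. *)
Fixpoint blockfun (m : nat) (e : nat -> int) (V : nat) : K :=
  if m is m'.+1 then widthop V (e 0%N + e 1%N) (blockfun m' (fun r => e r.+1))
  else (V == 0%N)%:R.

Lemma blockfun0 m e : blockfun m e 0 = 1.
Proof. by elim: m e => [|m IHm] e //=; apply: IHm. Qed.

Lemma eq_blockfun m e e' V :
  (forall r, (r <= m)%N -> e r = e' r) -> blockfun m e V = blockfun m e' V.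
Proof.
elim: m e e' V => [|m IHm] e e' V eqe //=.
by apply: eq_widthop => [|w]; [rewrite !eqe | apply: IHm => r le_rm;
  rewrite eqe].
Qed.

(** This is G_m of the header: [altblock0] and [altblockS] are its recursion, with (q)_n / (q)_t
    written as a product to avoid division by zero. *)
Definition altblock m z : K := altsum 0 z (blockfun m (fun=> 0)).

Lemma altblock0 z : altblock 0 z = eps z.
Proof.
rewrite /altblock /altsum big_nat_recr //= subnn gbinn big_nat_cond big1 ?add0r
  ?mulr1 //.
move=> i; rewrite andbT => /andP[_ lt_iz].
by rewrite (_ : (z - i == 0)%N = false) ?mulr0 //; lia.
Qed.

(** * Closed forms for nonzero q *)

Hypothesis nzq : q != 0.

Lemma eps_neq0 a : eps a != 0.
Proof. by rewrite mulf_neq0 ?expf_neq0 // oppr_eq0 oner_eq0. Qed.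

(** The kernel k_v(S; w) in closed form. By [widthcoefS0] and [widthcoefSS] it obeys the recursion
    that defines [widthop]; hence [widthopE]. *)
Definition widthcoef (v : nat) (S : int) (w : nat) : K :=
  [v, w] * q ^ (- (w%:Z * (1 + v%:Z + S))) *
  \prod_(0 <= i < v - w) (1 - q ^ (i%:Z - S - v%:Z)).

Lemma widthcoefS0 v S :
  widthcoef v.+1 S 0 = widthcoef v S 0 * (1 - q ^ (- (S + v%:Z + 0%:Z + 1))).
Proof.
rewrite /widthcoef !gbin0 !subn0 !mul0r oppr0 !mul1r big_nat_recl // mulrC.
congr (_ * _); last by congr (1 - q ^ _); lia.
by apply: eq_bigr => i _; congr (1 - q ^ _); lia.
Qed.

Lemma widthcoefSS v S w : (w <= v)%N ->
  widthcoef v.+1 S w.+1 =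
  widthcoef v S w.+1 * (1 - q ^ (- (S + v%:Z + w.+1%:Z + 1))) +
  widthcoef v S w * q ^ (- (S + v%:Z + w%:Z + 2)).
Proof.
rewrite leq_eqVlt => /predU1P[->|lt_wv].
  rewrite /widthcoef !gbinn gbin_small // !mul0r add0r !subnn !big_geq //
    !mulr1 !mul1r.
  by rewrite -expfzDr //; congr (q ^ _); lia.
rewrite /widthcoef subSS (_ : v - w = (v - w.+1).+1)%N; last by lia.
rewrite [X in _ = _ + _ * X * _]big_nat_recr // [X in _ * X =
  _]big_nat_recl //=.
rewrite (_ : (v - w.+1)%:Z - S - v%:Z = - (w.+1%:Z + S)); last by lia.
rewrite (_ : \prod_(0 <= i < v - w.+1) (1 - q ^ (i.+1%:Z - S - v.+1%:Z)) =
             \prod_(0 <= i < v - w.+1) (1 - q ^ (i%:Z - S - v%:Z))); last first.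
  by apply: eq_bigr => i _; congr (1 - q ^ _); lia.
(* All terms share the factor E * P. What remains is [v+1, w+1] (1 - A), expanded by [gbinS] in the
   part free of A and by [gbinS'] in the part with A. *)
set P := \prod_(_ <= _ < _) _; set A := q ^ (0%:Z - S - v.+1%:Z).
set E := q ^ (- (w.+1%:Z * (1 + v.+1%:Z + S))).
have -> : q ^ (- (w.+1%:Z * (1 + v%:Z + S))) = E * q ^+ w.+1.
  by rewrite exprnP -expfzDr //; congr (q ^ _); lia.
have eB : q ^ (- (w%:Z * (1 + v%:Z + S))) * q ^ (- (S + v%:Z + w%:Z + 2)) = E.
  by rewrite -expfzDr //; congr (q ^ _); lia.
have eC : q ^+ w.+1 * q ^ (- (S + v%:Z + w.+1%:Z + 1)) = A.
  by rewrite exprnP -expfzDr //; congr (q ^ _); lia.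
have eD : q ^ (- (w.+1%:Z + S)) = A * q ^+ (v - w).
  by rewrite exprnP -expfzDr //; congr (q ^ _); lia.
set Y := q ^ (- (S + v%:Z + w%:Z + 2)) in eB *.
rewrite [X in _ = _ + X](_ : _ = [v, w] * (1 - q ^ (- (w.+1%:Z + S))) *
  (q ^ (- (w%:Z * (1 + v%:Z + S))) * Y) * P); last by ring.
rewrite eB eD; set Z := q ^ (- (S + v%:Z + w.+1%:Z + 1)) in eC *.
transitivity ((q ^+ w.+1 * [v, w.+1] - [v, w.+1] * (q ^+ w.+1 * Z)
   + [v, w] * (1 - A * q ^+ (v - w))) * E * P); last by ring.
rewrite eC; transitivity (([v.+1, w.+1] - A * [v.+1, w.+1]) * E * P);
  first by ring.
by rewrite {1}gbinS gbinS'; ring.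
Qed.

Lemma widthopE v S h : widthop v S h =
  \sum_(0 <= w < v.+1) widthcoef v S w * h w.
Proof.
elim: v h => [|v IHv] h.
  by rewrite big_nat1 /widthcoef gbin0 subn0 big_geq // mul0r oppr0 !mul1r.
rewrite /= IHv; under [LHS]eq_bigr do rewrite mulrDr !mulrA.
rewrite big_split /= [in RHS]big_nat_recl // widthcoefS0.
rewrite [in LHS]big_nat_recl // -addrA; congr (_ + _).
have k0 : widthcoef v S v.+1 = 0 by rewrite /widthcoef gbin_small ?mul0r.
have -> : \sum_(0 <= i < v) widthcoef v S i.+1 * (1 - q ^ (- (S + v%:Z +
  i.+1%:Z + 1))) * h i.+1 =
   \sum_(0 <= i < v.+1) widthcoef v S i.+1 * (1 - q ^ (- (S + v%:Z + i.+1%:Z +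
     1))) * h i.+1.
  by rewrite [RHS]big_nat_recr //= k0 !mul0r addr0.
rewrite -big_split; apply: eq_big_nat => i /andP[_ le_iv] /=.
by rewrite widthcoefSS //; ring.
Qed.

(** This is the sum over t = y_r - x_r announced in the header. After trinomial revision it is the
    q-binomial theorem with a = q^(-(1+S+v)). *)
Lemma widthcoef_sum v S w :
  \sum_(0 <= t < v.+1) [v, t] * [t,
    w] * (eps (t - w) * q ^ (- (t%:Z * (1 + S + v%:Z))))
  = widthcoef v S w.
Proof.
rewrite sum_gbin_trinomial // /widthcoef -mulrA; have [lt_vw|le_wv] := ltnP v w.
  by rewrite gbin_small // !mul0r.
congr (_ * _); set a := q ^ (- (1 + S + v%:Z)).
rewrite (_ : \prod_(_ <= _ < _) _ =
  \prod_(0 <= i < v - w) (1 - a * q ^+ i.+1)); last first.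
  by apply: eq_bigr => i _; rewrite exprnP -expfzDr //; congr (1 - q ^ _); lia.
rewrite -qbinomial big_distrr; apply: eq_bigr => t _.
rewrite addKn [a ^+ t]exprnP exprz_exp /=.
have -> : q ^ (- ((w + t)%:Z * (1 + S + v%:Z))) =
  q ^ (- (w%:Z * (1 + v%:Z + S))) * q ^ (- (1 + S + v%:Z) * t%:Z).
  by rewrite -expfzDr //; congr (q ^ _); lia.
by ring.
Qed.

(** With t outermost, the sum over the inner width gives [altblock m t], and the alternating sum
    over s gives the product, by the q-binomial theorem with a = q^t. *)
Lemma altblockS m z :
  altblock m.+1 z = \sum_(0 <= t < z.+1)
     [z, t] * q ^ (- (t%:Z * (1 + z%:Z))) *
       \prod_(0 <= i < z - t) (1 - q ^+ (t + i.+1)) * altblock m t.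
Proof.
(* [widthcoef_sum] splits the kernel; after w -> t - w, the sum over w is [altblock m t]. *)
have eqH V : (V <= z)%N -> blockfun m.+1 (fun=> 0) V =
    \sum_(0 <= t < z.+1) [V, t] * q ^ (- (t%:Z * (1 + V%:Z))) * altblock m t.
  move=> le_Vz; rewrite (@sum_nat_widen _ V) => [||t lt_Vt]; last 2 first.
  - by rewrite ltnS.
  - by rewrite gbin_small // !mul0r.
  rewrite /= addr0 widthopE.
  transitivity (\sum_(0 <= w < V.+1) \sum_(0 <= t < V.+1)
     [V, t] * q ^ (- (t%:Z * (1 + V%:Z))) * (eps (t - w) * [t,
       w] * blockfun m (fun=> 0) w)).
    apply: eq_bigr => w _; rewrite -widthcoef_sum big_distrl;
      apply: eq_bigr => t _.
    by rewrite addr0 /=; ring.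
  rewrite exchange_big_nat; apply: eq_big_nat => t /andP[_ le_tV].
  rewrite -big_distrr /=; congr (_ * _).
  rewrite (@sum_nat_widen _ t) // => [|w lt_tw]; last first.
    by rewrite gbin_small // mulr0 mul0r.
  rewrite sum_nat_rev; apply: eq_big_nat => w /andP[_ le_wt].
  by rewrite subKn // gbin_sub // mul0n mulr1.
rewrite /altblock /altsum.
transitivity (\sum_(0 <= s < z.+1) \sum_(0 <= t < z.+1)
   eps s * [z, s] * [z - s,
     t] * q ^ (- (t%:Z * (1 + z%:Z))) * q ^+ (t * s) * altblock m t).
  apply: eq_big_nat => s /andP[_ lt_s]; rewrite eqH ?leq_subr // big_distrr.
  apply: eq_bigr => t _ /=.
  have -> : q ^ (- (t%:Z * (1 + (z - s)%:Z))) =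
    q ^ (- (t%:Z * (1 + z%:Z))) * q ^+ (t * s).
    by rewrite exprnP -expfzDr //; congr (q ^ _); nia.
  by rewrite mul0n; ring.
rewrite exchange_big_nat; apply: eq_big_nat => t /andP[_ lt_t].
rewrite -/(altsum 0 t _) -/(altblock m t) -big_distrl /=; congr (_ * _).
rewrite (@sum_nat_widen _ (z - t)) => [||s lt_s]; last 2 first.
- by rewrite ltnS leq_subr.
- have [le_sz|lt_zs] := leqP s z;
  last by rewrite [gbin q z s]gbin_small // mulr0 !mul0r.
  by rewrite [gbin q (z - s) t]gbin_small ?mulr0 ?mul0r //; lia.
rewrite (_ : \prod_(_ <= _ < _) _ =
  \prod_(0 <= i < z - t) (1 - q ^+ t * q ^+ i.+1)); last first.
  by apply: eq_bigr => i _; rewrite exprD.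
rewrite -qbinomial big_distrr; apply: eq_big_nat => s /andP[_ lt_s] /=.
rewrite (_ : eps s * [z, s] * [z - s, t] = eps s * ([z, z - s] * [z - s, t]));
  last first.
  by rewrite gbin_sub ?mulrA //; lia.
rewrite gbin_trinomial; last by lia.
rewrite -exprM (_ : z - s - t = z - t - s)%N; last by lia.
by rewrite gbin_sub; [ring | lia].
Qed.

End Operators.

(** * Sums over one block *)

(** Monotonicity is not imposed, because the binomials vanish on the other sequences; so a sum over
    sequences is an iterated sum over their blocks. *)
Fixpoint lists (N r : nat) : seq (seq nat) :=
  if r is r'.+1 then [seq k :: l | k <- index_iota 0 N,
    l <- lists N r'] else [:: [::]].

Section Lists.
Variables (R : nmodType) (N : nat).

Lemma mem_lists r l : (l \in lists N r) = (size l == r) && all (fun k =>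
  k < N)%N l.
Proof.
elim: r l => [|r IHr] [|k l] //=.
  by apply/allpairsP => -[[x y] /= [_ _ ]].
rewrite eqSS; apply/allpairsP/idP => [[[x y] /= [x_in y_in [-> ->]]]|].
  by move: x_in y_in; rewrite mem_index_iota IHr => /= -> /andP[-> ->].
move=> /andP[sz_l /andP[lt_k all_l]]; exists (k, l).
by rewrite mem_index_iota IHr sz_l.
Qed.

Lemma size_lists r l : l \in lists N r -> size l = r.
Proof. by rewrite mem_lists => /andP[/eqP]. Qed.

Lemma big_lists0 (f : seq nat -> R) : \sum_(l <- lists N 0) f l = f [::].
Proof. by rewrite big_seq1. Qed.

Lemma big_lists_cons r (f : seq nat -> R) :
  \sum_(l <- lists N r.+1) f l =
  \sum_(0 <= k < N) \sum_(l <- lists N r) f (k :: l).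
Proof. by rewrite /= big_allpairs_dep. Qed.

Lemma big_lists_cat r s (f : seq nat -> R) :
  \sum_(l <- lists N (r + s)) f l =
  \sum_(u <- lists N r) \sum_(v <- lists N s) f (u ++ v).
Proof.
elim: r f => [|r IHr] f; first by rewrite big_lists0.
rewrite addSn !big_lists_cons; apply: eq_bigr => k _.
by rewrite IHr.
Qed.

Lemma big_lists_rcons r (f : seq nat -> R) :
  \sum_(l <- lists N r.+1) f l =
  \sum_(0 <= k < N) \sum_(l <- lists N r) f (rcons l k).
Proof.
rewrite -addn1 big_lists_cat exchange_big big_lists_cons; apply: eq_bigr => k _.
by rewrite big_lists0; apply: eq_bigr => l _; rewrite cats1.
Qed.

End Lists.

Arguments lists : simpl never.

Section Block.
Variables (K : fieldType) (q : K).
Local Notation "[ n , k ]" := (gbin q n k) (at level 0, format "[ n ,  k ]").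

Hypothesis nzq : q != 0.

(* A block is y 1, ..., y (2m+1): in the notation of the header,
   x_(r+1) = y (r+1) and y_r = y (2m+1-r), and e_(r+1) is e r.  For m = 0, which
   only occurs in inductions on m, y 1 is both x_1 and y_0. *)
Definition bexp (m : nat) (e : nat -> int) (y : nat -> nat) : int :=
  \sum_(0 <= r < m)
    (((y r.+1)%:Z - (y (2 * m - r)%N)%:Z) *
       (1 + e r + e r.+1 + (y (2 * m - r).+1)%:Z)
     + (y r.+1)%:Z * ((y (2 * m - r)%N)%:Z - (y r.+2)%:Z)).

(** The [eps] and the binomial at the last index 2m+1 are left out; [weightS] supplies them. *)
Definition bweight (m : nat) (e : nat -> int) (y : nat -> nat) : K :=
  eps q (y m.+1) * \prod_(1 <= i < (2 * m).+1) [y i.+1, y i] * q ^ bexp m e y.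

(** This is w_(r+1). For r = m both ends are the middle index, and the value is 0. *)
Definition bwidth (m : nat) (y : nat -> nat) (r : nat) : int :=
  (y (2 * m - r).+1)%:Z - (y r.+1)%:Z.

Lemma bweightS m e x z c : size c = (2 * m).+1 ->
  bweight m.+1 e (part (x :: rcons c z)) =
  [part c 1, x] * [z, part c (2 * m).+1] *
  q ^ ((x%:Z - (part c (2 * m).+1)%:Z) * (1 + e 0%N + e 1%N + z%:Z)
       + x%:Z * ((part c (2 * m).+1)%:Z - (part c 1)%:Z)) *
  bweight m (fun r => e r.+1) (part c).
Proof.
move=> sz_c; set y := part _.
have y1 : y 1%N = x by [].
have yS i : (0 < i <= (2 * m).+1)%N -> y i.+1 = part c i.
  case: i => // i /= le_i; rewrite /y /part /= nth_rcons sz_c.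
  by rewrite ltnS in le_i; rewrite ltnS le_i.
have yz : y (2 * m).+3 = z by rewrite /y /part /= nth_rcons sz_c ltnn eqxx.
rewrite /bweight [in LHS]/bexp (_ : 2 * m.+1 = (2 * m).+2)%N; last by lia.
rewrite yS; last by lia.
rewrite big_nat_recl // big_nat_recr //= y1 yz yS // yS; last by lia.
rewrite (@eq_big_nat _ _ _ 1 (2 * m).+1 _ (fun i => [part c i.+1, part c i]));
  last first.
  by move=> i /andP[? ?]; rewrite !yS //; lia.
rewrite [X in _ * q ^ X = _]big_nat_recl // expfzDr // subn0 y1 yz !yS //;
  last by lia.
rewrite (_ : \sum_(0 <= i < m) _ = bexp m (fun r => e r.+1) (part c));
  last first.
  apply: eq_big_nat => r /andP[_ lt_rm].
  rewrite (_ : (2 * m).+2 - r.+1 = (2 * m - r).+1)%N; last by lia.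
  by rewrite !yS //; lia.
by ring.
Qed.

Lemma bwidth0 m x z c : size c = (2 * m).+1 ->
  bwidth m.+1 (part (x :: rcons c z)) 0 = z%:Z - x%:Z.
Proof.
move=> sz_c; rewrite /bwidth subn0 (_ : 2 * m.+1 = (2 * m).+2)%N; last by lia.
by rewrite /part /= nth_rcons sz_c ltnn eqxx.
Qed.

Lemma bwidthS m x z c r : size c = (2 * m).+1 -> (r <= m)%N ->
  bwidth m.+1 (part (x :: rcons c z)) r.+1 = bwidth m (part c) r.
Proof.
move=> sz_c le_rm; rewrite /bwidth (_ : 2 * m.+1 - r.+1 = (2 * m - r).+1)%N;
  last by lia.
by rewrite /part /= !nth_rcons sz_c !ltnS leq_subr (leq_trans le_rm) //; lia.
Qed.

(* Peels the outermost layer off a block: b and c are x_2 and y_1. *)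
Lemma block_layer N x z V (S : int) (h : nat -> K) : (z < N)%N ->
  \sum_(0 <= b < N) \sum_(0 <= c < N)
    [b, x] * [z, c] * q ^ ((x%:Z - c%:Z) * (1 + S + z%:Z) + x%:Z *
      (c%:Z - b%:Z)) *
    (eps q b * [c, b] *
     widthop q V (S + (z%:Z - x%:Z) + (c%:Z - b%:Z)) (fun u =>
       h (c - b + u)%N)) =
  eps q x * [z, x] * widthop q (z - x + V) S h.
Proof.
move=> lt_zN; rewrite exchange_big_nat.
pose phi b c := q ^ ((x%:Z - c%:Z) * (1 + S + z%:Z) + x%:Z * (c%:Z - b%:Z)) *
  eps q b *
     widthop q V (S + (z%:Z - x%:Z) + (c%:Z - b%:Z)) (fun u => h (c - b + u)%N).
(* Here w = c - b is the width of the next layer. *)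
transitivity (\sum_(0 <= c < N) [z, c] * [c, x] *
    \sum_(0 <= w < (c - x).+1) [c - x, w] * phi (c - w)%N c).
  apply: eq_big_nat => c /andP[_ lt_cN];
    rewrite -mulrA -(sum_gbin_trinomial_rev q x (phi^~ c) lt_cN).
  by rewrite big_distrr; apply: eq_bigr => b _; rewrite /phi /=; ring.
rewrite sum_gbin_trinomial //; have [lt_zx|le_xz] := ltnP z x.
  by rewrite gbin_small // mulr0 !mul0r.
rewrite [eps q x * _]mulrC -mulrA; congr (_ * _).
(* The composition law separates the width z - x of this block from the width V of the blocks
   below. *)
rewrite -widthop_comp // widthopE // big_distrr.
transitivity (\sum_(0 <= t < (z - x).+1) \sum_(0 <= w < (z - x).+1)
  [z - x, t] * ([t, w] * phi (x + t - w)%N (x + t)%N)).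
  apply: eq_big_nat => t /andP[_ lt_t]; rewrite big_distrr addKn.
  rewrite [RHS](@sum_nat_widen _ t) // => w lt_tw.
  by rewrite [gbin q t w]gbin_small // mul0r mulr0.
rewrite exchange_big_nat; apply: eq_big_nat => w /andP[_ lt_w].
rewrite -widthcoef_sum // big_distrl /= big_distrr;
  apply: eq_big_nat => t /andP[_ lt_t] /=.
have [lt_tw|le_wt] := ltnP t w;
  first by rewrite [gbin q t w]gbin_small // !(mul0r, mulr0).
rewrite /phi -addnBA // epsD.
rewrite (_ : x + t - (x + (t - w)) = w)%N; last by lia.
rewrite (_ : (x + t)%:Z - (x + (t - w))%:Z = w%:Z); last by lia.
rewrite (_ : (z - x)%N%:Z = z%:Z - x%:Z); last by lia.
set k := widthop _ _ _ _.
rewrite exprnP.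
have -> : q ^ (- (t%:Z * (1 + S + (z%:Z - x%:Z)))) =
   q ^ ((x%:Z - (x + t)%:Z) * (1 + S + z%:Z) + x%:Z * w%:Z) * q ^ (x *
     (t - w))%N%:Z.
  by rewrite -expfzDr //; congr (q ^ _); nia.
by ring.
Qed.

(** Induction on m: [widthopE] expands the outermost layer's action on the lower blocks into a sum
    over u, the induction hypothesis sums the inner layers, and [block_layer] reassembles. It is
    applied to a g that carries the factors of the outermost layer, so g must be arbitrary. *)
Lemma block_sum N m e V (g : nat -> nat -> K) :
  \sum_(l <- lists N (2 * m).+1)
     bweight m e (part l) * g (part l 1) (part l (2 * m).+1) *
     blockfun q m (fun r => e r + bwidth m (part l) r) V =
  \sum_(0 <= x < N) \sum_(0 <= z < N)
     g x z * (eps q x * [z, x] * blockfun q m e (z - x + V)).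
Proof.
elim: m e V g => [|m IHm] e V g.
  (* For m = 0 the block is a single index. On the right, the binomial kills z < x and [blockfun]
     kills z > x. *)
  rewrite muln0 big_lists_cons; apply: eq_big_nat => x /andP[_ lt_xN].
  rewrite big_lists0 /= (bigD1_seq x) ?mem_index_iota ?iota_uniq //=.
  rewrite subnn gbinn big1 ?addr0 => [|z ne_zx].
    by rewrite /bweight /bexp !big_geq // expr0z !mulr1; ring.
  have [lt_zx|le_xz] := ltnP z x;
    first by rewrite gbin_small // !(mulr0, mul0r).
  by rewrite (_ : (z - x + V == 0)%N = false) ?mulr0 //; lia.
rewrite (_ : 2 * m.+1 = (2 * m).+2)%N; last by lia.
rewrite big_lists_cons; apply: eq_big_nat => x /andP[_ lt_xN].
rewrite big_lists_rcons; apply: eq_big_nat => z /andP[_ lt_zN].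
rewrite -[blockfun q m.+1 e _]/(widthop q (z - x + V) (e 0%N +
  e 1%N) (blockfun q m (fun r => e r.+1))).
rewrite -(block_layer _ _ _ _ lt_zN) big_distrr.
pose e' r := e r.+1.
transitivity (\sum_(0 <= u < V.+1) \sum_(c <- lists N (2 * m).+1)
   bweight m e' (part c) *
   (g x z * ([part c 1, x] * [z, part c (2 * m).+1] *
     q ^ ((x%:Z - (part c (2 * m).+1)%:Z) * (1 + (e 0%N + e 1%N) + z%:Z)
       + x%:Z * ((part c (2 * m).+1)%:Z - (part c 1)%:Z)) *
     widthcoef q V (e 0%N + e 1%N + (z%:Z - x%:Z) + ((part c (2 *
       m).+1)%:Z - (part c 1)%:Z)) u)) *
   blockfun q m (fun r => e' r + bwidth m (part c) r) u).
  rewrite exchange_big; apply: eq_big_seq => c /size_lists sz_c.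
  rewrite bweightS // /= widthopE // bwidth0 // bwidthS // big_distrr.
  apply: eq_big_nat => u _ /=.
  rewrite (_ : e 0%N + _ + _ =
    e 0%N + e 1%N + (z%:Z - x%:Z) + bwidth m (part c) 0); last by ring.
  rewrite {1 2}/bwidth subn0 (@eq_blockfun _ _ _ _ (fun r =>
    e' r + bwidth m (part c) r)) => [|r le_rm].
    rewrite (_ : part (x :: rcons c z) (2 * m).+3 = z).
      by rewrite -[part (x :: _) 1]/x [1 + (_ + _)]addrA -/e'; ring.
    by rewrite /part /= nth_rcons sz_c ltnn eqxx.
  by rewrite -/(bwidth m.+1 _ r.+1) bwidthS.
transitivity (\sum_(0 <= u < V.+1) \sum_(0 <= b < N) \sum_(0 <= c < N)
   g x z * ([b, x] * [z, c] *
     q ^ ((x%:Z - c%:Z) * (1 + (e 0%N + e 1%N) + z%:Z) + x%:Z * (c%:Z - b%:Z)) *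
     widthcoef q V (e 0%N + e 1%N + (z%:Z - x%:Z) + (c%:Z - b%:Z)) u) *
     (eps q b * [c, b] * blockfun q m e' (c - b + u))).
  apply: eq_bigr => u _.
  exact: (IHm e' u (fun b c => g x z * ([b, x] * [z, c] *
     q ^ ((x%:Z - c%:Z) * (1 + (e 0%N + e 1%N) + z%:Z) + x%:Z * (c%:Z - b%:Z)) *
     widthcoef q V (e 0%N + e 1%N + (z%:Z - x%:Z) + (c%:Z - b%:Z)) u))).
rewrite exchange_big_nat; apply: eq_bigr => b _.
rewrite exchange_big_nat big_distrr; apply: eq_bigr => c _.
rewrite widthopE // !big_distrr; apply: eq_bigr => u _ /=.
by rewrite /e'; ring.
Qed.

End Block.

(** * Splitting the summand of F into blocks *)

Lemma big_nat_shift (R : Type) (idx : R) (op : Monoid.law idx) a b (P : pred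
  nat) (F : nat -> R) :
  \big[op/idx]_(1 <= i < (a + b).+1 | P i) F i =
  op (\big[op/idx]_(1 <= i < a.+1 | P i) F i)
     (\big[op/idx]_(1 <= i < b.+1 | P (a + i)%N) F (a + i)%N).
Proof.
rewrite (@big_cat_nat _ _ _ a.+1) //=; last by lia.
congr (op _ _); rewrite -[a.+1]add1n big_addn -addnS addKn.
by apply: eq_big => i; rewrite addnC.
Qed.

Lemma exchange_big_triangle (R : nmodType) n (F : nat -> nat -> R) :
  \sum_(1 <= j < n.+1) \sum_(1 <= i < j) F i j =
  \sum_(1 <= i < n.+1) \sum_(i.+1 <= j < n.+1) F i j.
Proof.
elim: n => [|n IHn]; first by rewrite !big_geq.
rewrite big_nat_recr //= IHn [RHS]big_nat_recr //=.
rewrite [X in _ = _ + X]big_geq // addr0 -big_split /=.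
by apply: eq_big_nat => i /andP[_ lt_in]; rewrite [RHS]big_nat_recr.
Qed.

Section Exponents.
Variable m : nat.
Local Notation M := (2 * m).+1.

(** An absent factor counts as exponent 0, so that the exponent depends only on residues. *)
Definition cDelta (i j : nat) : int :=
  if ~~ (M %| i)%N && (j != m.+1 %[mod M])%N then Delta m i j else 0.

(* The exponents [beta] with the interactions with the blocks above included. *)
Definition sbeta (e : nat -> int) (i : nat) : int :=
  let r := (i %% M)%N in
  if (1 <= r <= m)%N then 1 + e r.-1 + e r
  else if (m.+1 <= r <= 2 * m)%N then - (1 + e (2 * m - r)%N + e (2 * m - r).+1)
  else 0.

Lemma cDelta_mod i i' j j' : i = i' %[mod M] -> j = j' %[mod M] -> cDelta i j =
  cDelta i' j'.
Proof.
move=> eqi eqj; rewrite /cDelta /Delta !addn1 /dvdn eqi eqj.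
rewrite -(modnDm i) -(modnDm i') eqi eqj -(addn1 i) -(addn1 i').
by rewrite -(modnDm i 1) -(modnDm i' 1) eqi.
Qed.

Lemma sbeta_mod e i i' : i = i' %[mod M] -> sbeta e i = sbeta e i'.
Proof. by rewrite /sbeta => ->. Qed.

Lemma modn_lt2 x : (x < 2 * M)%N -> (x %% M = if x < M then x else x - M)%N.
Proof.
move=> lt_x; case: ltnP => [|le_Mx]; first exact: modn_small.
by rewrite -{1}(subnK le_Mx) modnDr modn_small //; lia.
Qed.

(* For s = m+1, where the definition of F has no factor, its terms cancel. *)
Lemma cDeltaE r s : (1 <= r <= 2 * m)%N -> (1 <= s <= M)%N ->
  cDelta r s = (s == M - r)%N%:Z +
    (s == (M - r).+1)%N%:Z - (s == r)%N%:Z - (s == r.+1)%N%:Z.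
Proof.
move=> r_in s_in; rewrite /cDelta /Delta addn1 /dvdn !modn_lt2; try by lia.
do 7![case: ltnP => ?; try by lia].
all: by repeat case: ifP => ?; lia.
Qed.

Lemma cDelta0 i j : (M %| i)%N -> cDelta i j = 0.
Proof. by rewrite /cDelta => ->. Qed.

Lemma sum_delta a b k (f : nat -> int) :
  \sum_(a <= s < b) (s == k)%N%:Z * f s = (a <= k < b)%N%:Z * f k.
Proof.
have [k_in|k_notin] := boolP (a <= k < b)%N.
  rewrite (bigD1_seq k) ?mem_index_iota ?iota_uniq //= eqxx big1 ?addr0 // => s.
  by move=> /negPf ->; rewrite mul0r.
rewrite mul0r big_nat_cond big1 // => s; rewrite andbT => s_in.
by case: eqP => [eq_sk|_]; [rewrite -eq_sk s_in in k_notin | rewrite mul0r].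
Qed.

Lemma sum_cDelta a r (f : nat -> int) : (1 <= a)%N -> (1 <= r <= 2 * m)%N ->
  \sum_(a <= s < M.+1) cDelta r s * f s =
  (a <= M - r < M.+1)%N%:Z * f (M - r)%N + (a <= (M - r).+1 < M.+1)%N%:Z *
    f (M - r).+1
  - (a <= r < M.+1)%N%:Z * f r - (a <= r.+1 < M.+1)%N%:Z * f r.+1.
Proof.
move=> a1 r_in; rewrite -!sum_delta -big_split -!sumrB /=.
by apply: eq_big_nat => s s_in; rewrite cDeltaE //; [ring | lia].
Qed.

(** The four terms of [cDeltaE] regroup, up to sign, into two consecutive widths of y. A block thus
    acts on the indices below it only through its widths, which are added to e. *)
Lemma sum_cDelta_shift i (e : nat -> int) (y : nat -> nat) :
  \sum_(1 <= s < M.+1) cDelta i s * (y s)%:Z + sbeta e i =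
  sbeta (fun r => e r + bwidth m y r) i.
Proof.
rewrite (sbeta_mod e (esym (modn_mod i M))) (sbeta_mod _ (esym (modn_mod i M))).
under eq_bigr do rewrite (cDelta_mod (esym (modn_mod i M)) (erefl (_ %% M)%N)).
have : (i %% M < M)%N by rewrite ltn_mod.
set r := (i %% M)%N; rewrite ltnS => le_r.
have [->|r_gt0] := posnP r.
  rewrite big1 ?add0r => [|s _]; first by rewrite /sbeta mod0n.
  by rewrite cDelta0 ?dvdn0 // mul0r.
rewrite sum_cDelta //; last by lia.
rewrite /sbeta modn_small // r_gt0 le_r /bwidth /=.
have -> : (0 < M - r < M.+1)%N = true by lia.
have -> : ((M - r).+1 < M.+1)%N = true by lia.
have -> : (r < M.+1)%N = true by lia.
have -> : (r.+1 < M.+1)%N = true by lia.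
have [le_rm|lt_mr] := leqP r m.
  rewrite (_ : 2 * m - r.-1 = M - r)%N; last by lia.
  rewrite (_ : (2 * m - r).+1 = M - r)%N; last by lia.
  by rewrite prednK //= !mul1r; ring.
rewrite (_ : 2 * m - (2 * m - r) = r)%N; last by lia.
rewrite (_ : 2 * m - (2 * m - r).+1 = r.-1)%N; last by lia.
rewrite prednK // (_ : (2 * m - r).+1 = M - r)%N; last by lia.
by rewrite /= !mul1r; ring.
Qed.

Lemma sum_fold (f : nat -> int) k :
  \sum_(1 <= i < (2 * k).+1) f i = \sum_(0 <= r < k) (f r.+1 + f (2 * k - r)%N).
Proof.
rewrite mul2n -addnn big_nat_shift big_split /=; congr (_ + _).
  by rewrite big_add1.
rewrite big_add1 /= big_nat_rev /=; apply: eq_big_nat => r /andP[_ lt_rk].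
by congr f; lia.
Qed.

Definition pairs (n : nat -> nat) (R : nat) : int :=
  \sum_(1 <= j < R.+1) \sum_(1 <= i < j) cDelta i j * (n i * n j)%N%:Z.

Definition wexp (e : nat -> int) (n : nat -> nat) (R : nat) : int :=
  pairs n R + \sum_(1 <= i < R.+1) sbeta e i * (n i)%:Z.

(** [sum_fold] pairs x_(r+1) = y (r+1) with y_(r+1) = y (2m-r); in each of these two rows
    [sum_cDelta] keeps only the entries beyond the diagonal. *)
Lemma wexp_block e y : wexp e y M = bexp m e y.
Proof.
have -> : wexp e y M = \sum_(1 <= i < M.+1) (y i)%:Z *
   (\sum_(i.+1 <= j < M.+1) cDelta i j * (y j)%:Z + sbeta e i).
  under [RHS]eq_bigr do rewrite mulrDr.
  rewrite big_split; congr (_ + _); last by apply: eq_bigr => i _;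
    rewrite mulrC.
  rewrite /pairs exchange_big_triangle; apply: eq_bigr => i _.
  by rewrite big_distrr; apply: eq_bigr => j _; rewrite PoszM /=; ring.
(* The last index has no later partner in the block, and its [sbeta] is 0. *)
rewrite big_nat_recr // sum_fold /= [X in _ + X](_ : _ = 0); last first.
  by rewrite big_geq // add0r /sbeta modnn mulr0.
rewrite addr0; apply: eq_big_nat => r /andP[_ lt_rm].
rewrite !sum_cDelta //; try by lia.
rewrite /sbeta !modn_small; try by lia.
have -> : (0 < r.+1 <= m)%N = true by lia.
have -> : (0 < 2 * m - r <= m)%N = false by lia.
have -> : (m < 2 * m - r <= 2 * m)%N = true by lia.
have -> : (r.+1 < M - r.+1 < M.+1)%N = true by lia.
have -> : (r.+1 < (M - r.+1).+1 < M.+1)%N = true by lia.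
have -> : (r.+1 < r.+1 < M.+1)%N = false by lia.
have -> : (r.+1 < r.+2 < M.+1)%N = true by lia.
have -> : (2 * m - r < M - (2 * m - r) < M.+1)%N = false by lia.
have -> : (2 * m - r < (M - (2 * m - r)).+1 < M.+1)%N = false by lia.
have -> : (2 * m - r < 2 * m - r < M.+1)%N = false by lia.
have -> : (2 * m - r < (2 * m - r).+1 < M.+1)%N = true by lia.
rewrite subSS (_ : 2 * m - (2 * m - r) = r)%N; last by lia.
by rewrite /= !mul1r !mul0r; ring.
Qed.

(** [sum_cDelta_shift] absorbs the pairs that join lower blocks to the top one into e. The pairs
    inside the top block give [bexp], since the exponents are periodic. *)
Lemma wexp_cat e n p :
  wexp e n (p * M + M) =
  wexp (fun r => e r + bwidth m (fun s => n (p * M + s)%N) r) n (p * M) +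
  bexp m e (fun s => n (p * M + s)%N).
Proof.
have modM i : p * M + i = i %[mod M] by rewrite modnMDl.
rewrite -wexp_block /wexp /pairs !big_nat_shift.
have -> : \sum_(1 <= i < M.+1) sbeta e (p * M + i) * (n (p * M + i)%N)%:Z =
   \sum_(1 <= i < M.+1) sbeta e i * (n (p * M + i)%N)%:Z.
  by apply: eq_bigr => i _; rewrite (sbeta_mod _ (modM i)).
have -> : \sum_(1 <= j < M.+1) \sum_(1 <= i < p * M + j) cDelta i (p * M + j) *
  (n i * n (p * M + j))%N%:Z =
  \sum_(1 <= j < M.+1) \sum_(1 <= i < (p * M).+1) cDelta i j * (n i * n (p *
    M + j))%N%:Z +
  \sum_(1 <= j < M.+1) \sum_(1 <= i < j) cDelta i j * (n (p * M + i) * n (p *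
    M + j))%N%:Z.
  rewrite -big_split; apply: eq_big_nat => -[//|j] _.
  rewrite addnS big_nat_shift /=; congr (_ + _); apply: eq_bigr => i _.
    by rewrite -addnS (cDelta_mod (erefl _) (modM j.+1)).
  by rewrite -addnS (cDelta_mod (modM i) (modM j.+1)).
have -> : \sum_(1 <= i < (p * M).+1) sbeta (fun r => e r + bwidth m (fun s =>
  n (p * M + s)%N) r) i * (n i)%:Z =
  \sum_(1 <= j < M.+1) \sum_(1 <= i < (p * M).+1) cDelta i j * (n i * n (p *
    M + j))%N%:Z
  + \sum_(1 <= i < (p * M).+1) sbeta e i * (n i)%:Z.
  rewrite exchange_big_nat -big_split; apply: eq_bigr => i _.
  rewrite -sum_cDelta_shift mulrDl big_distrl; congr (_ + _);
    apply: eq_bigr => j _.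
  by rewrite PoszM /=; ring.
by rewrite /=; ring.
Qed.

Variables (K : fieldType) (q : K).
Hypothesis nzq : q != 0.
Local Notation "[ n , k ]" := (gbin q n k) (at level 0, format "[ n ,  k ]").

Definition signed (i : nat) := (i == m.+1 %[mod M])%N || (i == M %[mod M])%N.

(* [n (p * M).+1] is the first index of the next block above. *)
Definition weight (e : nat -> int) (p : nat) (n : nat -> nat) : K :=
  q ^ wexp e n (p * M) * (\prod_(1 <= i < (p * M).+1 | signed i) eps q (n i)) *
  \prod_(1 <= i < (p * M).+1) [n i.+1, n i].

Lemma weight0 e n : weight e 0 n = 1.
Proof. by rewrite /weight /wexp /pairs !big_geq // addr0 expr0z !mulr1. Qed.

Lemma weightS e p n : (0 < m)%N -> let y := fun s => n (p * M + s)%N in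
  weight e p.+1 n =
  weight (fun r => e r + bwidth m y r) p n *
  (eps q (y M) * [y M.+1, y M] * bweight q m e y).
Proof.
move=> m_gt0 y; rewrite /weight mulSn addnC wexp_cat expfzDr // !big_nat_shift.
(* As 0 < m, the positions m+1 and 2m+1 differ, so each block carries two signs. *)
have -> : \prod_(1 <= i < M.+1 | signed (p * M + i)) eps q (n (p * M + i)%N) =
   eps q (y m.+1) * eps q (y M).
  transitivity (\prod_(1 <= i < M.+1) if (i == m.+1) || (i == M) then eps q (y
    i) else 1).
    rewrite big_mkcond; apply: eq_big_nat => i /andP[i_gt0 le_iM].
    rewrite /signed !modnMDl modnn; congr (if _ then _ else _).
    rewrite [(m.+1 %% M)%N]modn_small; last by lia.
    have [->|lt_iM] := eqVneq i M; first by rewrite modnn eqxx !orbT.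
    by rewrite modn_small; lia.
  rewrite big_nat_recr //= eqxx orbT; congr (_ * _).
  rewrite (bigD1_seq m.+1) ?mem_index_iota ?iota_uniq //=; last by lia.
  rewrite eqxx /= big_seq_cond big1 ?mulr1 // => i;
    rewrite mem_index_iota => /andP[i_in ne_im].
  by rewrite (negPf ne_im) (_ : (i == M) = false) //; lia.
have -> : \prod_(1 <= i < M.+1) [n (p * M + i).+1, n (p * M + i)%N] =
  \prod_(1 <= i < M) [y i.+1, y i] * [y M.+1, y M].
  rewrite [LHS]big_nat_recr //= /y -addnS; congr (_ * _).
  by apply: eq_bigr => i _; rewrite -addnS.
by rewrite /bweight -/y /=; ring.
Qed.

End Exponents.

Section Ext.
Variables (K : fieldType) (q : K) (m : nat).
Local Notation M := (2 * m).+1.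
Local Notation "[ n , k ]" := (gbin q n k) (at level 0, format "[ n ,  k ]").

Lemma eq_bwidth y y' r : (forall i, (1 <= i <= M)%N -> y i =
  y' i) -> (r <= m)%N ->
  bwidth m y r = bwidth m y' r.
Proof. by move=> eqy le_rm; rewrite /bwidth !eqy //; lia. Qed.

Lemma eq_bweight e y y' : (forall i, (1 <= i <= M)%N -> y i = y' i) ->
  bweight q m e y = bweight q m e y'.
Proof.
move=> eqy; rewrite /bweight eqy; last by lia.
congr (_ * _ * q ^ _); apply: eq_big_nat => i i_in; rewrite !eqy //; lia.
Qed.

Lemma eq_sbeta e e' i : (forall r, (r <= m)%N -> e r = e' r) -> sbeta m e i =
  sbeta m e' i.
Proof.
move=> eqe; rewrite /sbeta; have : (i %% M < M)%N by rewrite ltn_mod.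
by move: (i %% M)%N => r lt_r; case: ifP => [|_]; [|case: ifP => //] => r_in;
  rewrite !eqe //; lia.
Qed.

Lemma eq_weight e e' p n n' : (forall r, (r <= m)%N -> e r = e' r) ->
  (forall i, (1 <= i <= (p * M).+1)%N -> n i = n' i) ->
  weight m q e p n = weight m q e' p n'.
Proof.
move=> eqe eqn; rewrite /weight /wexp; congr (q ^ (_ + _) * _ * _).
- apply: eq_big_nat => j j_in; apply: eq_big_nat => i i_in.
  by rewrite !eqn //; lia.
- by apply: eq_big_nat => i i_in; rewrite (eq_sbeta _ eqe) eqn //; lia.
- rewrite big_nat_cond [RHS]big_nat_cond; apply: eq_bigr => i /andP[i_in _].
  by rewrite eqn //; lia.
by apply: eq_big_nat => i i_in; rewrite !eqn //; lia.
Qed.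

End Ext.

(** * Summation over all blocks *)

Section WeightSum.
Variables (K : fieldType) (q : K) (m N : nat).
Hypotheses (nzq : q != 0) (m_gt0 : (0 < m)%N).
Local Notation M := (2 * m).+1.
Local Notation "[ n , k ]" := (gbin q n k) (at level 0, format "[ n ,  k ]").

Definition gaussop (f : nat -> K) (n : nat) : K :=
  \sum_(0 <= s < N) q ^+ (s ^ 2 + s) * [n, s] * f s.

(** This is B_p of the header at arguments n < N, where the binomials vanish for s > n. *)
Definition gausschain (p : nat) : nat -> K := iter p gaussop (fun n =>
  (n == 0%N)%:R).

Lemma weight_cat e p l c z : size l = (p * M)%N -> size c = M ->
  weight m q e p.+1 (part (rcons (l ++ c) z)) =
  weight m q (fun r =>
    e r + bwidth m (part c) r) p (part (rcons l (part c 1))) *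
  (eps q (part c M) * [z, part c M] * bweight q m e (part c)).
Proof.
move=> sz_l sz_c; rewrite weightS //.
set y := fun s => part _ (p * M + s).
rewrite -/(y M) -/(y M.+1).
have yE i : (1 <= i <= M)%N -> y i = part c i.
  case: i => // i /andP[_ lt_iM];
    rewrite /y /part addnS /= nth_rcons nth_cat size_cat sz_l sz_c.
  by rewrite ltn_add2l lt_iM ltnNge leq_addr /= addKn.
have -> : y M.+1 = z.
  by rewrite /y /part addnS /= nth_rcons size_cat sz_l sz_c ltnn eqxx.
rewrite yE; last by lia.
rewrite (eq_bweight _ _ yE); congr (_ * _);
  apply: eq_weight => [r le_rm|i i_in].
  by rewrite (eq_bwidth yE).
have [lt_ip|le_pi] := leqP i (p * M).
  rewrite /part !nth_rcons nth_cat size_cat sz_l sz_c.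
  have lt_ip' : (i.-1 < p * M)%N by lia.
  by rewrite lt_ip' ltn_addr.
have -> : i = (p * M + 1)%N by lia.
by rewrite -/(y 1%N) yE // /part addn1 nth_rcons sz_l ltnn eqxx.
Qed.

(** The induction step of [weight_sum], with an arbitrary factor g of the last index: g = [y, .]
    continues the induction, and [F_pos_core] takes g from the summand of F. Repeating the last
    index as its own upper neighbour makes the linking binomial 1. *)
Lemma weight_sum_last p :
  (forall e y, (y < N)%N ->
    \sum_(l <- lists N (p * M)) weight m q e p (part (rcons l y)) =
    \sum_(0 <= z < N) [y,
      z] * eps q z * altsum q 0 z (blockfun q m e) * gausschain p z) ->
  forall e (g : nat -> K),
    \sum_(l <- lists N (p.+1 * M))
       g (part l (p.+1 * M)) * weight m q e p.+1 (part (rcons l (part l (p.+1 *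
         M)))) =
    \sum_(0 <= z < N) g z * eps q z * altsum q 0 z (blockfun q m e) *
      gausschain p.+1 z.
Proof.
move=> IHp e g; rewrite mulSn addnC big_lists_cat exchange_big /=.
transitivity (\sum_(0 <= y < N) \sum_(0 <= j < y.+1) \sum_(c <- lists N M)
   bweight q m e (part c) *
   (g (part c M) * eps q (part c M) * (eps q y * [part c 1,
     y] * (eps q j * q ^+ (0 * j) * [y, j]) * gausschain p y)) *
   blockfun q m (fun r => e r + bwidth m (part c) r) (y - j)).
  under [RHS]eq_bigr do rewrite exchange_big.
  rewrite [RHS]exchange_big; apply: eq_big_seq => c c_in;
    have sz_c := size_lists c_in.
  have lt_c1 : (part c 1 < N)%N.
    move: c_in; rewrite mem_lists => /andP[_ /allP]; apply.
    by rewrite mem_nth // sz_c.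
  transitivity (\sum_(l <- lists N (p * M)) g (part c M) * eps q (part c M) *
    bweight q m e (part c) *
     weight m q (fun r =>
       e r + bwidth m (part c) r) p (part (rcons l (part c 1)))).
    apply: eq_big_seq => l /size_lists sz_l.
    have -> : part (l ++ c) (p * M + M) = part c M.
      by rewrite /part addnS /= nth_cat sz_l ltnNge leq_addr addKn.
    by rewrite weight_cat // gbinn; ring.
  (* The lower blocks see c only through its first index and its widths. *)
  rewrite -big_distrr IHp //= big_distrr; apply: eq_bigr => y _.
  by rewrite /altsum /= mulr_sumr mulr_suml mulr_sumr; apply: eq_bigr => j _;
    ring.
(* [block_sum] with V = y - j leaves only the first index x and the last index z of the top
   block. *)
transitivity (\sum_(0 <= y < N) \sum_(0 <= j < y.+1) \sum_(0 <= x < N) \sum_(0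
  <= z < N)
   (g z * eps q z * (eps q y * [x, y] * (eps q j * q ^+ (0 * j) * [y,
     j]) * gausschain p y)) *
   (eps q x * [z, x] * blockfun q m e (z - x + (y - j)))).
  apply: eq_bigr => y _; apply: eq_bigr => j _.
  exact: (block_sum nzq N m e (y - j) (fun x z => g z * eps q z *
     (eps q y * [x, y] * (eps q j * q ^+ (0 * j) * [y, j]) * gausschain p y))).
transitivity (\sum_(0 <= z < N) \sum_(0 <= y < N) g z * eps q z *
  gausschain p y *
   \sum_(0 <= x < N) [z, x] * [x,
     y] * (eps q x * eps q y * altsum q 0 y (fun t =>
       blockfun q m e (z - x + t)%N))).
  rewrite [RHS]exchange_big_nat; apply: eq_bigr => y _.
  under [RHS]eq_bigr do rewrite big_distrr.
  rewrite [RHS]exchange_big_nat [LHS]exchange_big_nat; apply: eq_bigr => x _.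
  rewrite exchange_big_nat; apply: eq_bigr => z _.
  by rewrite /altsum !big_distrr; apply: eq_bigr => j _ /=; ring.
apply: eq_big_nat => z /andP[_ lt_zN]; rewrite /= /gaussop big_distrr.
by apply: eq_bigr => y _; rewrite altsum_twist //=; ring.
Qed.

Lemma weight_sum p e y : (y < N)%N ->
  \sum_(l <- lists N (p * M)) weight m q e p (part (rcons l y)) =
  \sum_(0 <= z < N) [y,
    z] * eps q z * altsum q 0 z (blockfun q m e) * gausschain p z.
Proof.
elim: p e y => [|p IHp] e y lt_yN.
  rewrite big_lists0 weight0 (bigD1_seq 0%N) ?mem_index_iota ?iota_uniq //=;
    last by lia.
  rewrite big1 => [|z /negPf nz]; last by rewrite nz mulr0.
  by rewrite eps0 gbin0 /altsum big_nat1 eps0 gbin0 blockfun0 // mul0n !mul1r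
    addr0.
rewrite -[RHS](weight_sum_last IHp e (gbin q y)).
apply: eq_big_seq => l /size_lists sz_l.
have sz_t : size (take (p * M) l) = (p * M)%N by rewrite size_takel // sz_l;
  lia.
have sz_d : size (drop (p * M) l) = M by rewrite size_drop sz_l; lia.
have lastl : part l (p.+1 * M) = part (drop (p * M) l) M.
  by rewrite /part nth_drop; congr nth; lia.
rewrite -{1 3}(cat_take_drop (p * M) l) !weight_cat // lastl gbinn; ring.
Qed.

End WeightSum.

(** * From finitely supported sums to bounded sums *)

Lemma fsbig_inj (R : nmodType) (I J : choiceType) (h : I -> J) (D : set I)
    (P : pred J) (r : seq J) (f : J -> R) :
  injective h -> uniq r -> (h @` D = [set` P])%classic ->
  (forall j, P j -> j \notin r -> f j = 0) ->
  \sum_(i \in D) f (h i) = \sum_(j <- r | P j) f j.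
Proof.
move=> inj_h uniq_r imP f0; rewrite -fsbig_image; last by move=> x y _ _ /inj_h.
by rewrite imP; apply/esym/bigfs.
Qed.

Lemma lists_uniq N r : uniq (lists N r).
Proof.
elim: r => // r IHr; apply: allpairs_uniq; rewrite ?iota_uniq //.
by move=> [k l] [k' l'] _ _ /= [-> ->].
Qed.

Lemma sorted_last_big N r l : (0 < r)%N -> size l = r -> sorted leq l ->
  l \notin lists N r -> (N <= part l r)%N.
Proof.
move=> r_gt0 sz_l sorted_l; rewrite leqNgt; apply: contra => lt_lN.
rewrite mem_lists sz_l eqxx; apply/(all_nthP 0%N) => i lt_i.
apply: leq_ltn_trans lt_lN; apply: (sorted_leq_nth leq_trans leqnn) => //;
  rewrite ?inE; lia.
Qed.

Lemma chain_image r :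
  ((@tval r nat) @` chain r = [set` fun l =>
    (size l == r) && sorted leq l])%classic.
Proof.
apply/seteqP; split => [l /= [t ch_t <-]|l /= /andP[sz_l sorted_l]].
  by rewrite unfold_in size_tuple eqxx.
by exists (Tuple sz_l).
Qed.

Lemma fsbig_chain (R : nmodType) N r (f : seq nat -> R) : (0 < r)%N ->
  (forall l, (N <= part l r)%N -> f l = 0) ->
  \sum_(t \in chain r) f t = \sum_(l <- lists N r | sorted leq l) f l.
Proof.
move=> r_gt0 f0; rewrite (fsbig_inj val_inj (lists_uniq N r) (chain_image r))
  => [|l]; last first.
  by move=> /andP[/eqP sz_l sorted_l] l_notin; apply/f0/sorted_last_big.
rewrite big_seq_cond [RHS]big_seq_cond; apply: eq_bigl => l.
by have [/size_lists->|] := boolP (l \in lists N r); rewrite ?eqxx.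
Qed.

Lemma fsbig_U_index (R : nmodType) N r s (f : seq nat -> seq nat -> R) :
  (0 < r)%N -> (0 < s)%N ->
  (forall l l', (N <= part l r)%N -> f l l' = 0) ->
  \sum_(ns \in U_index r s) f ns.1 ns.2 =
  \sum_(l <- lists N r | sorted leq l) \sum_(l' <- lists N s | sorted leq l')
     if part l r == part l' s then f l l' else 0.
Proof.
move=> r_gt0 s_gt0 f0.
pose h (ns : r.-tuple nat * s.-tuple nat) := (tval ns.1, tval ns.2).
pose P (ll : seq nat * seq nat) := [&& (size ll.1 == r) && sorted leq ll.1,
  (size ll.2 == s) && sorted leq ll.2 & part ll.1 r == part ll.2 s].
pose ls := [seq (l, l') | l <- lists N r, l' <- lists N s].
rewrite -[LHS]/(\sum_(ns \in U_index r s) (fun ll => f ll.1 ll.2) (h ns)).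
rewrite (@fsbig_inj _ _ _ h _ P ls) /=.
- rewrite big_mkcond big_allpairs [RHS]big_mkcond /=;
  apply: eq_big_seq => l /size_lists sz_l.
  case: (boolP (sorted leq l)) => sorted_l; last first.
    by rewrite big1 // => l' _; rewrite /P /= (negPf sorted_l) andbF.
  rewrite [RHS]big_mkcond /=; apply: eq_big_seq => l' /size_lists sz_l'.
  by rewrite /P /= sz_l sz_l' !eqxx sorted_l; case: (sorted leq l').
- by move=> [a b] [a' b'] [/val_inj -> /val_inj ->].
- apply: allpairs_uniq; rewrite ?lists_uniq //.
  by move=> [? ?] [? ?].
- apply/seteqP; split => [_ /= [[n t] [/= ch_n ch_t eq_nt] <-]|[l l']].
    by rewrite unfold_in /P /h /= !size_tuple !eqxx eq_nt eqxx andbT;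
      apply/andP.
  move=> /and3P[/andP[/= sz_l sorted_l] /andP[/= sz_l' sorted_l'] /eqP eq_ll].
  by exists (Tuple sz_l, Tuple sz_l').
move=> [l l'] /and3P[/andP[/= /eqP sz_l sorted_l] /andP[/= /eqP sz_l'
  sorted_l'] /eqP eq_ll].
move=> notin; have [l_in|l_notin] := boolP (l \in lists N r); last first.
  exact/f0/sorted_last_big.
have [l_in'|l_notin'] := boolP (l' \in lists N s).
  by case/negP: notin; apply/allpairsP; exists (l, l').
by apply: f0; rewrite eq_ll; apply: sorted_last_big.
Qed.

(** The binomial vanishes at a descent; this lets sums over chains run over all of [lists]. *)
Lemma unsorted_gbin (K : fieldType) (q : K) r l : size l =
  r -> ~~ sorted leq l ->
  exists2 i, (1 <= i < r)%N & gbin q (part l i.+1) (part l i) = 0.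
Proof.
move=> <-; have [//|all_gt] := pselect (exists2 i,
  (1 <= i < size l)%N & gbin q (part l i.+1) (part l i) = 0).
case/negP; apply/(sortedP 0%N) => i lt_i; rewrite leqNgt; apply/negP => lt_l.
by apply: all_gt; exists i.+1 => //; apply: gbin_small.
Qed.

Lemma prod_gbin_unsorted (K : fieldType) (q : K) r l (c : nat -> K) : size l =
  r -> ~~ sorted leq l ->
  \prod_(1 <= i < r) (c i * gbin q (part l i.+1) (part l i)) = 0.
Proof.
move=> sz_l /(unsorted_gbin q sz_l)[i i_in eq0].
by rewrite (bigD1_seq i) ?mem_index_iota ?iota_uniq //= eq0 mulr0 mul0r.
Qed.

(** * Chain sums as iterated kernels *)

Section ChainSum.
Variables (K : fieldType) (N : nat) (c : nat -> nat -> K).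

Definition chainop (f : nat -> K) (n : nat) : K :=
  \sum_(0 <= k < N) c n k * f k.

Lemma eq_iter_chainop r f f' : f =1 f' -> iter r chainop f =1 iter r chainop f'.
Proof.
by move=> eqf; elim: r => //= r IHr n; apply: eq_bigr => k _; rewrite IHr.
Qed.

(** Only neighbours are coupled, as in a transfer matrix. In the induction on r, g takes over the
    kernel at the top index. *)
Lemma chain_sum r (a g : nat -> K) :
  \sum_(l <- lists N r.+1) a (part l 1) *
     \prod_(1 <= i < r.+1) c (part l i.+1) (part l i) * g (part l r.+1) =
  \sum_(0 <= z < N) g z * iter r chainop a z.
Proof.
elim: r g => [|r IHr] g.
  rewrite big_lists_cons; apply: eq_bigr => z _.
  by rewrite big_lists0 big_geq // mulr1 mulrC.
rewrite big_lists_rcons; apply: eq_bigr => z _;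
  rewrite iterS {1}/chainop big_distrr.
transitivity (\sum_(l <- lists N r.+1) a (part l 1) *
     \prod_(1 <= i < r.+1) c (part l i.+1) (part l i) * (g z *
       c z (part l r.+1))).
  apply: eq_big_seq => l /size_lists sz_l.
  have partl i : (1 <= i <= r.+1)%N -> part (rcons l z) i = part l i.
    by case: i => // i /andP[_ lt_i]; rewrite /part /= nth_rcons sz_l lt_i.
  have partz : part (rcons l z) r.+2 =
    z by rewrite /part /= nth_rcons sz_l ltnn eqxx.
  rewrite big_nat_recr //= partz (partl r.+1) ?leqnn // (partl 1%N) //.
  rewrite (@eq_big_nat _ _ _ 1 r.+1 _ (fun i => c (part l i.+1) (part l i)));
    first by ring.
  by move=> i i_in; rewrite !partl //; lia.
have /= -> := IHr (fun y => g z * c z y); apply: eq_bigr => y _ /=; by ring.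
Qed.

End ChainSum.

(** * Both sides at a root of unity of order d *)

Section RootOfUnity.
Variables (K : fieldType) (q : K).
Hypothesis nzq : q != 0.

(** Factor by factor, 1 - x = -x (1 - x^-1) with x = q^k. *)
Lemma qpoch_eps n : qpoch q q n = eps q n * qpoch q^-1 q^-1 n.
Proof.
elim: n => [|n IHn]; first by rewrite /qpoch !big_geq // eps0 mulr1.
rewrite !qpochS IHn epsS -!exprS exprVn.
have nz : q ^+ n.+1 != 0 by rewrite expf_neq0.
set x := q ^+ n.+1 in nz *; by field.
Qed.

Lemma qpoch_split t n : (t <= n)%N ->
  qpoch q q n = qpoch q q t * \prod_(0 <= i < n - t) (1 - q ^+ (t + i.+1)).
Proof.
move=> le_tn; rewrite /qpoch (@big_cat_nat _ _ _ t) //=; congr (_ * _).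
rewrite -{1}[t]add0n big_addn; apply: eq_bigr => i _.
by rewrite addnC addnS exprS.
Qed.

Variable d : nat.
Hypothesis (qd : forall n, (n < d)%N -> qpoch q q n != 0).

Local Notation Q := (q^-1).

Lemma qpochV_neq0 n : (n < d)%N -> qpoch Q Q n != 0.
Proof. by move=> /qd; rewrite qpoch_eps mulf_eq0 => /norP[]. Qed.

(** The sum over n_1, ..., n_m on the U side, in base Q, for a fixed n_(m+1). *)
Definition hchain m : nat -> K :=
  iter m (chainop d (fun n k => Q ^+ (k ^ 2 + k) * gbin Q n k)) (fun n =>
    (qpoch Q Q n)^-1).

(** [altblockS] becomes the recursion of [hchain]: the product there is (q)_n / (q)_t by
    [qpoch_split], and [gbin_inv] gives q^(-t-tn) [n, t]_q = Q^(t^2+t) [n, t]_Q. *)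
Lemma altblock_hchain m n : (n < d)%N -> altblock q m n =
  qpoch q q n * hchain m n.
Proof.
elim: m n => [|m IHm] n lt_nd.
  by rewrite altblock0 qpoch_eps /= mulfK ?qpochV_neq0.
rewrite altblockS // /hchain iterS {1}/chainop [X in _ =
  _ * X](@sum_nat_widen _ n) // => [|t lt_nt]; last first.
  by rewrite [gbin _ _ _]gbin_small // mulr0 mul0r.
rewrite big_distrr; apply: eq_big_nat => t /andP[_]; rewrite ltnS => le_tn /=.
rewrite IHm; last by apply: leq_ltn_trans lt_nd.
rewrite (qpoch_split le_tn) gbin_inv // exprVn.
have -> : q ^ (- (t%:Z * (1 + n%:Z))) = q ^- (t ^ 2 + t) * q ^- (t * (n - t)).
  rewrite !exprnN -expfzDr //; congr (q ^ _).
  by rewrite -(subnK le_tn) addnK; nia.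
by rewrite -/(hchain m); ring.
Qed.

(** The first [gaussop] turns the indicator of 0 into the constant 1, as only s = 0 survives. *)
Lemma gausschainE p n : (0 < d)%N -> gausschain q d p.+1 n =
  iter p (chainop d (fun n k => q ^+ (k ^ 2 + k) * gbin q n k)) (fun=> 1) n.
Proof.
move=> d_gt0; rewrite /gausschain iterSr; apply: eq_iter_chainop => {}n.
rewrite /gaussop (bigD1_seq 0%N) ?mem_index_iota ?iota_uniq //= big1 =>
  [|k /negPf->].
  by rewrite gbin0 !mulr1 addr0.
by rewrite mulr0.
Qed.

Lemma big_expfz (I : Type) (r : seq I) (P : pred I) (f : I -> int) :
  \prod_(i <- r | P i) q ^ f i = q ^ (\sum_(i <- r | P i) f i).
Proof. exact/esym/(big_morph (exprz q) (fun a b =>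
  expfzDr a b nzq) (expr0z q)). Qed.

Lemma epsV n : (-1) ^+ n * q ^ (- 'C(n.+1, 2)%:Z) = (eps q n)^-1.
Proof. by rewrite /eps invfM -[((-1) ^+ n)^-1]exprVn invrN1 exprnN. Qed.

(** The common value of both sides given in the header, cut off at d, from where on the summands of
    F and U vanish. *)
Definition core_sum m p : K :=
  q ^+ p * \sum_(0 <= z < d) qpoch Q Q z * altblock q m z * gausschain q d p z.

Hypothesis (qd0 : forall n, (d <= n)%N -> qpoch q q n = 0).
Hypothesis d_gt0 : (0 < d)%N.

(** One division by [eps q z] is the factor (-1)^z q^(-binomial(z+1, 2)) of F. The other removes the
    sign at the last index, which [weight] includes and F does not. *)
Lemma F_pos_summand_weight m p l :
  size l = (p.+1 * (2 * m).+1)%N -> let z := part l (p.+1 * (2 * m).+1) in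
  (if sorted leq l then F_pos_summand m p.+1 q l else 0) =
  qpoch q q z / eps q z / eps q z *
    weight m q (fun=> 0) p.+1 (part (rcons l z)).
Proof.
set R := (p.+1 * _)%N => sz_l z.
have nl i : (1 <= i <= R)%N -> part (rcons l z) i = part l i.
  by case: i => // i /andP[_ lt_i]; rewrite /part /= nth_rcons sz_l lt_i.
have nz : part (rcons l z) R.+1 =
  z by rewrite /part /= nth_rcons sz_l ltnn eqxx.
rewrite /weight -/R; case: ifPn => [sorted_l|unsorted_l]; last first.
  have [i i_in eq0] := unsorted_gbin q sz_l unsorted_l.
  rewrite [X in _ * (_ * X)](bigD1_seq i) ?mem_index_iota ?iota_uniq //=;
    last by lia.
  by rewrite !nl ?eq0 ?(mul0r, mulr0) //; lia.
rewrite /F_pos_summand addn1 mulnC -/R -/z -[_ * _ * q ^ _]mulrA epsV.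
have -> : \prod_(1 <= j < R.+1)
   \prod_(1 <= i < j | ~~ ((2 * m).+1 %| i)%N && (j != m.+1 %[mod (2 *
     m).+1])%N)
      q ^ (Delta m i j * (part l i * part l j)%N%:Z) =
        q ^ pairs m (part (rcons l z)) R.
  rewrite -big_expfz; apply: eq_big_nat => j j_in.
  rewrite -big_expfz big_mkcond; apply: eq_big_nat => i i_in.
  rewrite /cDelta !nl; try by lia.
  by case: ifP => //; rewrite mul0r expr0z.
have -> : \prod_(1 <= i < R.+1 | signed m i) eps q (part (rcons l z) i) =
  \prod_(1 <= i < R | signed m i) ((-1) ^+ part l i * q ^ 'C((part l i).+1,
    2)%:Z) * eps q z.
  rewrite big_mkcond [X in _ = X * _]big_mkcond big_nat_recr //=.
  rewrite nl ?leqnn // -/z (_ : signed m R);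
    last by rewrite /signed modnMl modnn eqxx orbT.
  by congr (_ * _); apply: eq_big_nat => i i_in; rewrite nl //; lia.
have -> : \prod_(1 <= i < R.+1) gbin q (part (rcons l z) i.+1) (part (rcons l
  z) i) =
  \prod_(1 <= i < R) gbin q (part l i.+1) (part l i).
  rewrite big_nat_recr //= nz nl ?leqnn // gbinn mulr1.
  by apply: eq_big_nat => i i_in; rewrite !nl //; lia.
have -> : \prod_(1 <= i < R) (q ^ (beta m i * (part l i)%:Z) *
  (qbin K (part l i.+1) (part l i)).[q]) =
  q ^ (\sum_(1 <= i < R.+1) sbeta m (fun=> 0) i * (part (rcons l z) i)%:Z) *
  \prod_(1 <= i < R) gbin q (part l i.+1) (part l i).
  rewrite [X in _ = q ^ X *
    _]big_nat_recr //= [sbeta m _ R]/sbeta modnMl mul0r addr0 -big_expfz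
      -big_split.
  apply: eq_big_nat => i i_in /=; rewrite nl; last by lia.
  rewrite qbin_gbin; last first.
    by apply: (sorted_leq_nth leq_trans leqnn) => //; rewrite ?inE ?sz_l; lia.
  rewrite /beta /sbeta addn1; congr (q ^ (_ * _) * _).
rewrite /wexp expfzDr //; have := eps_neq0 nzq z.
rewrite /signed; set e := eps q z => nze; by field.
Qed.

Lemma F_pos_core m p : (0 < m)%N -> F_pos m p.+1 q = core_sum m p.+1.
Proof.
move=> m_gt0; rewrite /F_pos /core_sum; congr (_ * _).
rewrite (@fsbig_chain _ d) => [||l le_d]; last 2 first.
- by rewrite addn1 muln_gt0.
- by rewrite /F_pos_summand qd0 // !mul0r.
rewrite big_mkcond addn1 mulnC.
rewrite (eq_big_seq _ (fun l lin => F_pos_summand_weight (size_lists lin))).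
rewrite (weight_sum_last nzq m_gt0 (@weight_sum _ _ _ _ nzq m_gt0 p) _
  (fun z => qpoch q q z / eps q z / eps q z)).
apply: eq_bigr => z _; rewrite qpoch_eps -/(altblock q m z).
by have := eps_neq0 nzq z; set e := eps q z => nze; field.
Qed.

(** For m = 0 this is already a chain sum with the kernel of B_p, and G_0 = eps turns (Q)_n into
    (q)_n. *)
Lemma F_zero_core p : F_zero p.+1 q = core_sum 0 p.+1.
Proof.
rewrite /F_zero /core_sum; congr (_ * _).
rewrite (@fsbig_chain _ d) // => [|l le_d]; last first.
  by rewrite /F_zero_summand qd0 // mul0r.
transitivity (\sum_(l <- lists d p.+1) 1 *
  \prod_(1 <= i < p.+1) (q ^+ (part l i ^ 2 + part l i) *
    gbin q (part l i.+1) (part l i)) *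
  qpoch q q (part l p.+1)).
  rewrite big_mkcond; apply: eq_big_seq => l /size_lists sz_l.
  case: ifPn => [sorted_l|unsorted_l]; last first.
    by rewrite prod_gbin_unsorted // mulr0 mul0r.
  rewrite /F_zero_summand mul1r mulrC; congr (_ * _).
  apply: eq_big_nat => i i_in; rewrite qbin_gbin //.
  by apply: (sorted_leq_nth leq_trans leqnn) => //; rewrite ?inE ?sz_l; lia.
have /= -> := chain_sum d (fun n k =>
  q ^+ (k ^ 2 + k) * gbin q n k) p (fun=> 1) (qpoch q q).
by apply: eq_bigr => z _;
  rewrite -gausschainE // altblock0 qpoch_eps [eps q z * _]mulrC.
Qed.

(** At x = -1 both numerator factors are (Q)_n; one absorbs the sign factor and becomes (q)_n. For a
    fixed common top index the two chain sums are independent, and give [hchain] and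
    [gausschain]. *)
Lemma U_core m p : U m.+1 p.+1 (-1) Q = core_sum m p.+1.
Proof.
rewrite /U /core_sum -exprVn invrK; congr (_ * _).
rewrite (@fsbig_U_index _ d) // => [|l l' le_d]; last first.
  have q0 : qpoch Q Q (part l m.+1) = 0.
    have /eqP := qd0 le_d; rewrite qpoch_eps mulf_eq0 (negPf (eps_neq0 nzq _)).
    by move/eqP.
  by rewrite /U_summand opprK mul1r q0 !mul0r.
pose A l := (qpoch Q Q (part l 1))^-1 *
  \prod_(1 <= i < m.+1) (Q ^+ (part l i ^ 2 + part l i) *
    gbin Q (part l i.+1) (part l i)).
pose B l := 1 *
  \prod_(1 <= i < p.+1) (q ^+ (part l i ^ 2 + part l i) *
    gbin q (part l i.+1) (part l i)).
transitivity (\sum_(l <- lists d m.+1) A l * \sum_(l' <- lists d p.+1)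
   B l' * (if part l' p.+1 == part l m.+1 then qpoch q q (part l m.+1) *
     qpoch Q Q (part l m.+1) else 0)).
  rewrite big_mkcond; apply: eq_big_seq => l /size_lists sz_l.
  case: ifPn => [sorted_l|unsorted_l]; last first.
    by rewrite /A prod_gbin_unsorted // mulr0 mul0r.
  rewrite big_mkcond big_distrr; apply: eq_big_seq => l' /size_lists sz_l'.
  case: ifPn => [sorted_l'|unsorted_l']; last first.
    by rewrite /= /B prod_gbin_unsorted // !(mulr0, mul0r).
  rewrite eq_sym; case: eqP => [eq_l|_]; last by rewrite /= !mulr0.
  rewrite /U_summand opprK mul1r (_ : - (-1)^-1 * Q = Q);
    last by rewrite invrN1 opprK mul1r.
  have epsQ n : (-1) ^+ n * Q ^ (- 'C(n.+1, 2)%:Z) = eps q n.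
    by rewrite /eps exprz_inv opprK.
  have sorted_part (t : seq nat) i r : size t =
    r.+1 -> sorted leq t -> (1 <= i < r.+1)%N ->
      (part t i <= part t i.+1)%N.
    move=> sz_t sorted_t i_in.
    by apply: (sorted_leq_nth leq_trans leqnn) => //; rewrite ?inE ?sz_t; lia.
  rewrite (@eq_big_nat _ _ _ 1 m.+1 _
    (fun i => Q ^+ (part l i ^ 2 + part l i) *
      gbin Q (part l i.+1) (part l i))); last first.
    by move=> i i_in; rewrite qbin_gbin // (sorted_part _ _ m).
  rewrite (@eq_big_nat _ _ _ 1 p.+1 _
    (fun i => q ^+ (part l' i ^ 2 + part l' i) *
      gbin q (part l' i.+1) (part l' i))); last first.
    (* Inverting the base turns Q^(-s-s's) [s', s]_Q into q^(s^2+s) [s', s]_q. *)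
    move=> i i_in; have le_i := sorted_part _ _ p sz_l' sorted_l' i_in.
    rewrite qbin_gbin // gbin_inv // mulrA; congr (_ * _).
    rewrite exprz_inv exprnN -expfzDr // exprnP; congr (q ^ _).
    by rewrite -(subnK le_i) addnK; nia.
  rewrite -[X in X * _ * _ = _]mulrA epsQ /A /B qpoch_eps /=; ring.
have H f : \sum_(l' <- lists d p.+1) B l' * f (part l' p.+1) =
  \sum_(0 <= z < d) f z * gausschain q d p.+1 z.
  have /= -> := chain_sum d (fun n k =>
    q ^+ (k ^ 2 + k) * gbin q n k) p (fun=> 1) f.
  by apply: eq_bigr => z _; rewrite -gausschainE.
under eq_bigr do rewrite (H (fun y => if y == _ then _ else 0)).
transitivity (\sum_(l <- lists d m.+1) A l *
  (qpoch q q (part l m.+1) * qpoch Q Q (part l m.+1) *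
    gausschain q d p.+1 (part l m.+1))).
  apply: eq_big_seq => l l_in; congr (_ * _).
  rewrite (bigD1_seq (part l m.+1)) ?iota_uniq //=; last first.
    rewrite mem_index_iota /=; move: (l_in);
      rewrite mem_lists => /andP[_ /allP]; apply.
    by rewrite mem_nth // (size_lists l_in).
  by rewrite eqxx big1 ?addr0 // => z /negPf ->; rewrite mul0r.
have /= -> := chain_sum d (fun n k =>
  Q ^+ (k ^ 2 + k) * gbin Q n k) m (fun z => (qpoch Q Q z)^-1)
  (fun z => qpoch q q z * qpoch Q Q z * gausschain q d p.+1 z).
apply: eq_big_nat => z /andP[_ lt_zd]; rewrite altblock_hchain // /hchain; ring.
Qed.

End RootOfUnity.

Unset Implicit Arguments.

Theorem corollary1p4 (C : numClosedFieldType) (m p N : nat) (zeta : C)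
  (p_ge1 : (1 <= p)%N) (N_ge1 : (1 <= N)%N) (zetaN : N.-unity_root zeta) :
  F m p zeta = U m.+1 p (-1) zeta^-1.
Proof.
(* [zeta] need not be primitive of order N; for its exact order d, (zeta)_n is nonzero precisely
   when n < d. *)
have [d prim_zeta _] := prim_order_exists N_ge1 (unity_rootP zetaN).
have d_gt0 := prim_order_gt0 prim_zeta.
have nz_zeta : zeta != 0.
  by apply: contraTneq (oner_neq0 C) => z0;
    rewrite -(prim_expr_order prim_zeta) z0 expr0n gtn_eqF // eqxx.
have zeta_big n : (d <= n)%N -> qpoch zeta zeta n = 0.
  by move=> le_dn; apply: (@qpoch_eq0 _ _ d); rewrite ?d_gt0 ?prim_expr_order.
have zeta_small n : (n < d)%N -> qpoch zeta zeta n != 0.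
  move=> lt_nd; rewrite /qpoch prodf_seq_neq0; apply/allP => k.
  rewrite mem_index_iota /= => lt_kn; rewrite -exprS subr_eq0 eq_sym.
  by rewrite -(prim_order_dvd prim_zeta) gtnNdvd //; lia.
case: p p_ge1 => // p _; rewrite (U_core nz_zeta zeta_small zeta_big d_gt0).
by rewrite /F; case: (posnP m) => [->|m_gt0];
  [apply: F_zero_core | apply: F_pos_core].
Qed.
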